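(* Fix $T\ge 1$ and suppose that condition $(C_\mu)$ (stated in the context) is satisfied. Let $\overline{\gamma}=(\overline{\gamma}(t,s),\,1\le s\le t\le T)$ be the unique solution of $$\overline{\gamma}(t,s)=K(t,s)-\sum_{l=1}^{s-1}\overline{\gamma}(t,l)\,\overline{\gamma}(s,l)\,\frac{S_l}{1+S_l\overline{\gamma}_l},\qquad S_l=A_l^2-\mu Q_l,\quad \overline{\gamma}_l=\overline{\gamma}(l,l),$$ and let $(\overline{h}_t)_{1\le t\le T}$ be the solution of $$\overline{h}_t=m_t+\sum_{l=1}^{t}A_l\,\overline{\gamma}(t,l)\,(Y_l-A_l\overline{h}_l),\qquad 1\le t\le T.$$ Then $\overline{h}$ is the solution of the linear exponential Gaussian (LEG) filtering problem, i.e. $$\overline{h}=\operatorname*{argmin}_{h:\,h_t\in\mathcal{Y}_t,\,t\ge1}\ \mathbb{E}\left[\mu\exp\left\{\frac{\mu}{2}\sum_{t=1}^T(X_t-h_t)^2Q_t\right\}\right],$$ the minimum being over all sequences $h=(h_t)$ such that each $h_t$ is $\mathcal{Y}_t$-measurable (that is, $\overline h$ is such a sequence and attains the minimum). Moreover the corresponding optimal risk is $$\mathbb{E}\left[\mu\exp\left\{\frac{\mu}{2}\sum_{t=1}^T(X_t-\overline{h}_t)^2Q_t\right\}\right]=\mu\prod_{t=1}^T\left[\frac{1+S_t\overline{\gamma}_t}{1+A_t^2\overline{\gamma}_t}\right]^{-1/2}.$$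
   Context: Setting: $X=(X_t)_{t\ge1}$ is an arbitrary real Gaussian sequence with mean $m_t=\mathbb{E}X_t$ and covariance $K(t,s)=\mathbb{E}(X_t-m_t)(X_s-m_s)$. The observations are $Y_t=A_tX_t+\varepsilon_t$, $t\ge 1$, where $(A_t)_{t\ge1}$ is a deterministic real sequence and $(\varepsilon_t)_{t\ge1}$ are i.i.d. $\mathcal{N}(0,1)$, independent of $X$. $\mathcal{Y}_t=\sigma(Y_u,\,1\le u\le t)$, and $h_t\in\mathcal{Y}_t$ means $h_t$ is $\mathcal{Y}_t$-measurable. $\mu$ is a fixed real number and $(Q_t)_{t\ge1}$ a fixed sequence of nonnegative real numbers. The expectation in the criterion may take the value $+\infty$ when $\mu>0$. Condition $(C_\mu)$ (for horizon $T$): the equation $$\overline{\gamma}(t,s)=K(t,s)-\sum_{l=1}^{s-1}\overline{\gamma}(t,l)\overline{\gamma}(s,l)\frac{S_l}{1+S_l\overline{\gamma}_l},\qquad S_l=A_l^2-\mu Q_l,\ \overline{\gamma}_l=\overline{\gamma}(l,l),$$ has a unique and bounded solution on $\{(t,s):1\le s\le t\le T\}$, such that $\overline{\gamma}_l\ge0$ and $1+S_l\overline{\gamma}_l>0$ for all $1\le l\le T$. *)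

(* Defs.v *)
From HB Require Import structures.
From mathcomp Require Export all_boot all_order all_algebra.
From mathcomp Require Export all_classical all_reals all_analysis.

Set Implicit Arguments.
Unset Strict Implicit.
Unset Printing Implicit Defensive.

Import Order.TTheory GRing.Theory Num.Theory.
Import numFieldNormedType.Exports.

Local Open Scope classical_set_scope.
Local Open Scope ring_scope.

(* All sequences (X_t)_{t >= 1}, (A_t)_{t >= 1}, ... are functions on nat whose
   value at 0 is irrelevant: every condition below is guarded by 1 <= t. *)

Section probability_notions.
Context {d : measure_display} {Omega : measurableType d} {R : realType}.
Variable P : probability Omega R.

(* N(m, s^2). The case s = 0 is the point mass at m, which [normal_prob m 0]
   (the uniform law on [0, 1]) is not. *)
Definition gaussian_law (m s : R) (B : set R) : \bar R :=
  if s == 0 then \d_m B else normal_prob m s B.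

Definition gaussian_variable (Z : Omega -> R) : Prop :=
  exists m s : R, forall B : set R, measurable B ->
    P (Z @^-1` B) = gaussian_law m s B.

Definition gaussian_sequence (X : nat -> Omega -> R) : Prop :=
  forall (n : nat) (c : nat -> R),
    gaussian_variable (fun w => \sum_(1 <= t < n.+1) c t * X t w).

(* The events {Z_i \in B}, i \in I, B Borel. *)
Definition sigma_generator (I : set nat) (Z : nat -> Omega -> R)
    : set (set Omega) :=
  \bigcup_(i in I) preimage_set_system setT (Z i) measurable.

Definition mutually_independent (I : set nat) (Z : nat -> Omega -> R) : Prop :=
  forall (s : seq nat) (B : nat -> set R), uniq s -> [set` s] `<=` I ->
    (forall i, i \in s -> measurable (B i)) ->
    P (\bigcap_(i in [set` s]) (Z i @^-1` B i)) =
    (\prod_(i <- s) P (Z i @^-1` B i))%E.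

Definition independent_sequences (I : set nat) (Z W : nat -> Omega -> R)
    : Prop :=
  forall E F : set Omega,
    <<s sigma_generator I Z >> E -> <<s sigma_generator I W >> F ->
    P (E `&` F) = (P E * P F)%E.

Definition iid_standard_normal (eps : nat -> Omega -> R) : Prop :=
  mutually_independent [set t | (1 <= t)%N] eps /\
  forall t, (1 <= t)%N -> forall B : set R, measurable B ->
    P (eps t @^-1` B) = normal_prob 0 1 B.

Definition has_mean_cov (X : nat -> Omega -> R) (m : nat -> R)
    (K : nat -> nat -> R) : Prop :=
  (forall t, (1 <= t)%N -> 'E_P[X t]%E = (m t)%:E) /\
  (forall t s, (1 <= t)%N -> (1 <= s)%N ->
    covariance P (X t) (X s) = (K t s)%:E).

End probability_notions.

Section riccati.
Context {R : realType}.
Variables (mu : R) (A Q : nat -> R) (K : nat -> nat -> R) (T : nat).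

Definition Scoef (l : nat) : R := A l ^+ 2 - mu * Q l.

(* As [x / 0 = 0], the denominators occurring in the equation (those with
   l < s <= T) are explicitly required to be nonzero. *)
Definition riccati_solution (g : nat -> nat -> R) : Prop :=
  (forall l, (1 <= l < T)%N -> 1 + Scoef l * g l l != 0) /\
  (forall t s, (1 <= s <= t)%N -> (t <= T)%N ->
    g t s = K t s - \sum_(1 <= l < s)
                      g t l * g s l * (Scoef l / (1 + Scoef l * g l l))).

Definition condition_C : Prop :=
  exists g : nat -> nat -> R,
    [/\ riccati_solution g,
        (forall g', riccati_solution g' ->
           forall t s, (1 <= s <= t)%N -> (t <= T)%N -> g' t s = g t s),
        (exists M : R, forall t s, (1 <= s <= t)%N -> (t <= T)%N ->
           `|g t s| <= M) &
        (forall l, (1 <= l <= T)%N -> 0 <= g l l /\ 0 < 1 + Scoef l * g l l)].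

End riccati.

Section filtering.
Context {d : measure_display} {Omega : measurableType d} {R : realType}.
Variable P : probability Omega R.
Variables (mu : R) (A Q : nat -> R) (T : nat).

Definition observation (X eps : nat -> Omega -> R) (t : nat) (w : Omega) : R :=
  A t * X t w + eps t w.

(* h_t is sigma(Y_1, ..., Y_t)-measurable; only the times t <= T enter the
   criterion. *)
Definition admissible (Y h : nat -> Omega -> R) : Prop :=
  forall t, (1 <= t <= T)%N ->
    let G := sigma_generator [set u | (1 <= u <= t)%N] Y in
    measurable_fun [set: g_sigma_algebraType G]
      (h t : g_sigma_algebraType G -> R).

(* Extended-real valued: it may be +oo when 0 < mu. *)
Definition leg_risk (X h : nat -> Omega -> R) : \bar R :=
  ('E_P[fun w => (mu *
    expR (mu / 2 * \sum_(1 <= t < T.+1) (X t w - h t w) ^+ 2 * Q t))%R])%E.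

Definition leg_optimal (X Y hbar : nat -> Omega -> R) : Prop :=
  admissible Y hbar /\
  forall h, admissible Y h -> (leg_risk X hbar <= leg_risk X h)%E.

Definition filter_equation (m : nat -> R) (g : nat -> nat -> R)
    (Y hbar : nat -> Omega -> R) : Prop :=
  forall t, (1 <= t <= T)%N -> forall w,
    hbar t w = m t + \sum_(1 <= l < t.+1) A l * g t l * (Y l w - A l * hbar l w).

End filtering.

(* Main.v *)
(* Replace [P] by the reference probability [nu] with density
   [exp (- sum_t (A_t X_t eps_t + (A_t X_t)^2 / 2))].  Under [nu] the
   observations are i.i.d. N(0,1), independent of [X], and [X] keeps its law.
   The exponential cost of a strategy [h] becomes the [nu]-expectation of an
   integral over [X] in which [Y] and [h(Y)] are frozen.  That integral is
   computed one time step at a time: multiplying by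
   [exp (B_t X_t - S_t X_t^2 / 2)] keeps [X] Gaussian and moves its mean and
   covariance by a Kalman-like step, whose covariance part is the equation for
   [gamma].  The cost is thus a product of explicit factors, the [t]-th one being
   a function of the predictor [z_t] of [X_t], of [h_t] and of [Y_t].  Completing
   the square in [h_t] gives the best value [hbar_t] and a factor whose integral
   in [Y_t], given the past, is a constant; removing the factors from the last
   one to the first yields both the optimality and the value of the risk.

   The Gaussian laws are handled through their moment generating functions.  A
   weight [exp (- S x^2 / 2)] with [S <= 0] is a mixture of exponentials
   [exp (w x)], and with [S > 0] a mixture of cosines [cos (w x)], whose integrals
   follow from the even moments, i.e. from the power series of [cosh]. *)

From HB Require Import structures.
Require Import Defs.
From mathcomp Require Import all_boot all_order all_algebra.
From mathcomp Require Import all_classical all_reals all_analysis.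
From mathcomp Require Import measurable_realfun normal_distribution.
From mathcomp Require Import ring lra.

Import Order.TTheory GRing.Theory Num.Theory.
Import numFieldNormedType.Exports HBNNSimple.

Local Open Scope classical_set_scope.
Local Open Scope ring_scope.

(** * Integrals against densities and independence *)

(** Linearity gives the formula for simple functions, and monotone convergence along [nnsfun_approx]
    extends it. The density is assumed only through the values of [nu] on measurable sets. *)
Lemma ge0_integral_density (d : measure_display) (T : measurableType d)
  (R : realType) (mu nu : {measure set T -> \bar R}) (f : T -> R) :
  measurable_fun setT f -> (forall x, 0 <= f x) ->
  (forall A, measurable A -> nu A = (\int[mu]_(x in A) (f x)%:E)%E) ->
  forall g : T -> \bar R, measurable_fun setT g -> (forall x, (0 <= g x)%E) ->
  (\int[nu]_x g x = \int[mu]_x (g x * (f x)%:E))%E.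
Proof.
move=> mf f0 nuE g mg g0.
pose h := nnsfun_approx measurableT mg.
have hE n : (\int[nu]_x (h n x)%:E = \int[mu]_x ((h n x)%:E * (f x)%:E))%E.
  transitivity (\sum_(k \in range (h n))
      \int[nu]_x (k * \1_(h n @^-1` [set k]) x)%:E)%E.
    under eq_integral do rewrite fimfunE -fsumEFin//.
    rewrite ge0_integral_fsum//.
    - by move=> y; exact/measurable_EFinP/measurable_funM.
    - by move=> y x _; rewrite nnfun_muleindic_ge0.
  transitivity (\sum_(k \in range (h n))
      \int[mu]_x ((k * \1_(h n @^-1` [set k]) x)%:E * (f x)%:E))%E; last first.
    rewrite -ge0_integral_fsum//.
    - apply: eq_integral => x _.
      rewrite [in RHS]fimfunE -fsumEFin// ge0_mule_fsuml//.
      by move=> k; rewrite nnfun_muleindic_ge0.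
    - move=> y; apply: emeasurable_funM; last exact/measurable_EFinP.
      exact/measurable_EFinP/measurable_funM.
    - by move=> y x _; rewrite mule_ge0// ?nnfun_muleindic_ge0// lee_fin.
  apply: eq_fsbigr => k /[!inE] -[x _ hx].
  have k0 : 0 <= k by rewrite -hx.
  rewrite integralZl_indic_nnsfun// integral_indic// setIT nuE//.
  rewrite integral_mkcond -ge0_integralZl_EFin//.
  - apply: eq_integral => y _; rewrite patchE indicE EFinM -muleA.
    by case: ifPn => yk; rewrite ?mul1e ?mul0e// mem_set.
  - by move=> y _; rewrite patchE; case: ifP => // _; rewrite lee_fin.
  - apply/(measurable_restrictT _ _).1 => //.
    exact/measurable_EFinP/measurable_funTS.
transitivity (limn (fun n => \int[nu]_x (h n x)%:E)%E).
  rewrite -monotone_convergence//.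
  - apply: eq_integral => y _; apply/esym/cvg_lim => //.
    exact: cvg_nnsfun_approx.
  - by move=> n; exact/measurable_EFinP/measurable_funP.
  - by move=> n y _; rewrite lee_fin.
  - by move=> y _ m n mn; rewrite lee_fin; exact/lefP/nd_nnsfun_approx.
under [fun n => _]eq_fun do rewrite hE.
rewrite -monotone_convergence//.
- apply: eq_integral => y _; apply/cvg_lim => //.
  by apply: cvgeZr => //; exact: cvg_nnsfun_approx.
- move=> n; apply: emeasurable_funM; exact/measurable_EFinP.
- by move=> n y _; rewrite mule_ge0// lee_fin.
- move=> y _ m n mn; rewrite lee_wpmul2r ?lee_fin//.
  exact/lefP/nd_nnsfun_approx.
Qed.

(** The joint law of [(U, V)] under [rho] is the product of the laws of [U] under [rho1] and of [V]
    under [rho2]; then Tonelli applies. Three probabilities are allowed because, later, [X] is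
    integrated under [P] and the observations under [nu]. *)
Lemma ge0_integral_independent (d d1 d2 : measure_display)
  (T : measurableType d) (T1 : measurableType d1) (T2 : measurableType d2)
  (R : realType) (rho rho1 rho2 : probability T R)
  (U : T -> T1) (V : T -> T2) :
  measurable_fun setT U -> measurable_fun setT V ->
  (forall A B, measurable A -> measurable B ->
    rho (U @^-1` A `&` V @^-1` B) = (rho1 (U @^-1` A) * rho2 (V @^-1` B))%E) ->
  forall g : T1 * T2 -> \bar R, measurable_fun setT g ->
  (forall z, (0 <= g z)%E) ->
  (\int[rho]_w g (U w, V w) =
   \int[rho1]_w \int[rho2]_w' g (U w, V w'))%E /\
  (\int[rho]_w g (U w, V w) =
   \int[rho2]_w' \int[rho1]_w g (U w, V w'))%E.
Proof.
move=> mU mV ind g mg g0.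
have mUV : measurable_fun setT (fun w => (U w, V w)) by exact/measurable_fun_pair.
have [U' UE] : exists U' : {mfun T >-> T1}, (U' : T -> T1) = U.
  by exists (mfun_Sub (mem_set mU)); rewrite mfun_valP.
have [V' VE] : exists V' : {mfun T >-> T2}, (V' : T -> T2) = V.
  by exists (mfun_Sub (mem_set mV)); rewrite mfun_valP.
have [W' WE] : exists W' : {mfun T >-> (T1 * T2)%type},
    (W' : T -> T1 * T2) = (fun w => (U w, V w)).
  by exists (mfun_Sub (mem_set mUV)); rewrite mfun_valP.
have UEw w : U' w = U w by rewrite -UE.
have VEw w : V' w = V w by rewrite -VE.
have WEw w : W' w = (U w, V w) by rewrite WE.
pose m1 := distribution rho1 U'; pose m2 := distribution rho2 V'.
have eqm X : measurable X -> (m1 \x m2)%E X = distribution rho W' X.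
  apply: product_measure_unique => A B mA mB.
  transitivity (rho (U @^-1` A `&` V @^-1` B)).
    by congr (rho _); apply/funext => w; rewrite /preimage /= WEw.
  rewrite ind//; congr (rho1 _ * rho2 _)%E; apply/funext => w;
    by rewrite /preimage /= ?UEw ?VEw.
have -> : (\int[rho]_w g (U w, V w) = \int[m1 \x m2]_z g z)%E.
  rewrite (eq_measure_integral (distribution rho W')); last first.
    by move=> A mA _; exact: eqm.
  rewrite ge0_integral_distribution//.
  by apply: eq_integral => w _; rewrite -WEw.
split.
- rewrite fubini_tonelli1// /fubini_F ge0_integral_distribution//; last 2 first.
  + exact: measurable_fun_fubini_tonelli_F.
  + by move=> x; apply: integral_ge0.
  apply: eq_integral => w _; rewrite -UEw /= ge0_integral_distribution//.
  + by apply: eq_integral => w' _; rewrite -VEw.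
  + exact: measurableT_comp.
- rewrite fubini_tonelli2// /fubini_G ge0_integral_distribution//; last 2 first.
  + exact: measurable_fun_fubini_tonelli_G.
  + by move=> x; apply: integral_ge0.
  apply: eq_integral => w _; rewrite -VEw /= ge0_integral_distribution//.
  + by apply: eq_integral => w' _; rewrite -UEw.
  + exact: measurableT_comp.
Qed.

(** Pi-lambda argument: cylinders are stable under intersection and generate the sigma-algebra. *)
Lemma cylinder_measure_unique (d : measure_display) (T : measurableType d)
  (R : realType) (m1 m2 : {measure set T -> \bar R}) (I : set nat)
  (Z : nat -> T -> R) :
  (forall i, measurable_fun setT (Z i)) -> (m1 setT < +oo)%E ->
  (forall B : nat -> set R, (forall i, measurable (B i)) ->
    m1 (\bigcap_(i in I) (Z i @^-1` B i)) =
    m2 (\bigcap_(i in I) (Z i @^-1` B i))) ->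
  forall E, <<s sigma_generator I Z >> E -> m1 E = m2 E.
Proof.
move=> mZ m1oo m12 E sE.
pose C : set (set T) := [set E | exists2 B : nat -> set R,
  (forall i, measurable (B i)) & E = \bigcap_(i in I) (Z i @^-1` B i)].
have CT : C setT.
  by exists (fun=> setT) => //; rewrite bigcapT.
have Cm : C `<=` measurable.
  move=> _ [B mB ->]; apply: bigcap_measurableType => i _.
  by rewrite -[_ @^-1` _]setTI; exact: mZ.
apply: (@g_sigma_algebra_measure_unique _ _ _ C Cm (fun=> setT)) => //.
- by rewrite bigcup_const//; exists 0%N.
- move=> _ _ [A mA ->] [B mB ->]; exists (fun i => A i `&` B i).
    by move=> i; exact: measurableI.
  by rewrite -bigcapI; apply: eq_bigcapr => i _; rewrite preimage_setI.
- by move=> _ [B mB ->]; exact: m12.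
- apply: (sub_sigma_algebra2 _ sE) => _ [i Ii [B mB <-]].
  (* A generator constrains one coordinate only: it is the cylinder whose other sides are [setT]. *)
  exists (fun j => if j == i then B else setT).
    by move=> j; case: ifP.
  rewrite setTI eqEsubset; split => [w Bw j Ij /=|w /(_ i Ii)/=].
    by case: eqP => // ->.
  by rewrite eqxx.
Qed.

(** * Integrals against normal laws *)

Section lebesgue_translation.
Context {R : realType}.
Local Notation mu := (@lebesgue_measure R).

Lemma lebesgue_measure_shift (a : R) (B : set R) :
  measurable B -> mu ((fun x => a + x) @^-1` B) = mu B.
Proof.
move=> mB.
have msh : @measurable_fun _ _ (measurableTypeR R) (measurableTypeR R) setT
    (fun x : R => a + x) by exact: measurable_funD.
pose sh : measurableTypeR R -> measurableTypeR R := fun x : R => a + x.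
have /(_ msh) h := @lebesgue_measure_unique R (pushforward mu sh).
rewrite [RHS](h _ B mB) // => X [[x y] _ <-]; rewrite /pushforward /=.
rewrite [X in _ = mu X](_ : _ = `](x - a), (y - a)]%classic); last first.
  by apply/seteqP; split => z /=; rewrite !in_itv/= ltrBlDl lerBrDl.
rewrite !lebesgue_measure_itv/= !lte_fin ltrD2r.
by case: ifP => // _; congr (_%:E); ring.
Qed.

Lemma ge0_integral_shift (a : R) (g : R -> \bar R) :
  measurable_fun setT g -> (forall x, (0 <= g x)%E) ->
  (\int[mu]_x g (a + x)%R = \int[mu]_x g x)%E.
Proof.
move=> mg g0.
have msh : @measurable_fun _ _ (measurableTypeR R) (measurableTypeR R) setT
    (fun x : R => a + x) by exact: measurable_funD.
pose sh : measurableTypeR R -> measurableTypeR R := fun x : R => a + x.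
transitivity (\int[pushforward mu sh]_x g x)%E.
  by rewrite ge0_integral_pushforward//= preimage_setT.
apply: eq_measure_integral => // B mB _.
exact: lebesgue_measure_shift.
Qed.

End lebesgue_translation.

Section normal_integrals.
Context {R : realType}.
Local Notation mu := (@lebesgue_measure R).

Lemma ge0_integral_normal (m s : R) (g : R -> \bar R) :
  measurable_fun setT g -> (forall x, (0 <= g x)%E) ->
  (\int[normal_prob m s]_x g x = \int[mu]_x (g x * (normal_pdf m s x)%:E))%E.
Proof.
move=> mg g0.
apply: (@ge0_integral_density _ (measurableTypeR R) R mu (normal_prob m s)
  (normal_pdf m s)) => //; first exact: measurable_normal_pdf.
by move=> x; exact: normal_pdf_ge0.
Qed.

Lemma measurable_normal_pdf_EFin (m s : R) :
  measurable_fun [set: measurableTypeR R] (fun x => (normal_pdf m s x)%:E).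
Proof. by apply/measurable_EFinP; exact: measurable_normal_pdf. Qed.

Lemma normal_pdf_expR (m s x : R) : s != 0 ->
  normal_pdf m s x = normal_peak s * expR (- (x - m) ^+ 2 / (s ^+ 2 *+ 2)).
Proof. by move=> s0; rewrite normal_pdfE. Qed.

(** Completing the square, [expR (u * x)] times the density of N(m, s^2) is a constant times the
    density of N(m + u s^2, s^2). *)
Lemma normal_mgf (m s u : R) : s != 0 ->
  (\int[normal_prob m s]_x (expR (u * x))%:E =
   (expR (u * m + u ^+ 2 * s ^+ 2 / 2))%:E)%E.
Proof.
move=> s0; rewrite ge0_integral_normal//; last first.
  by apply/measurable_EFinP; apply: measurableT_comp => //; exact: measurable_funM.
under eq_integral => x _.
  rewrite -EFinM (_ : expR _ * _ = expR (u * m + u ^+ 2 * s ^+ 2 / 2) *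
                              normal_pdf (m + u * s ^+ 2) s x); last first.
    rewrite !normal_pdf_expR// mulrCA [RHS]mulrCA. rewrite -!expRD.
    by congr (_ * expR _); field.
  rewrite EFinM; over.
rewrite ge0_integralZl_EFin ?expR_ge0// ?integral_normal_pdf ?mule1//.
- by move=> x _; rewrite lee_fin normal_pdf_ge0.
- exact: measurable_normal_pdf_EFin.
Qed.

(** The integrand times the standard density is a constant times the density of N(b / (1 + p), 1 /
    (1 + p)). A negative [p] is allowed as long as [1 + p] stays positive. *)
Lemma normal_exp_quadratic (p b : R) : 0 < 1 + p ->
  (\int[normal_prob 0 1]_x (expR (b * x - p / 2 * x ^+ 2))%:E =
   ((Num.sqrt (1 + p))^-1 * expR (b ^+ 2 / 2 / (1 + p)))%:E)%E.
Proof.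
move=> p0; rewrite ge0_integral_normal//; last first.
  apply/measurable_EFinP; apply: measurableT_comp => //.
  by apply: measurable_funB; apply: measurable_funM => //; exact: measurable_funX.
set s := (Num.sqrt (1 + p))^-1.
have s0 : 0 < s by rewrite invr_gt0 sqrtr_gt0.
have sE : s ^+ 2 = (1 + p)^-1 by rewrite exprVn sqr_sqrtr// ltW.
have pk : normal_peak 1 = s * normal_peak s :> R.
  rewrite /normal_peak expr1n mul1r -mulrnAr (sqrtrM _ (sqr_ge0 s)).
  by rewrite sqrtr_sqr gtr0_norm// invfM mulrA mulfV ?gt_eqF// mul1r.
under eq_integral => x _.
  rewrite -EFinM (_ : expR _ * _ = s * expR (b ^+ 2 / 2 / (1 + p)) *
                              normal_pdf (b / (1 + p)) s x); last first.
    rewrite !normal_pdf_expR ?oner_neq0 ?gt_eqF//= pk.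
    rewrite (mulrCA (expR _)) -[LHS]mulrA -expRD.
    rewrite -[RHS]mulrA (mulrCA (expR _)) -expRD.
    congr (_ * (_ * expR _)); rewrite sE; field.
    by rewrite gt_eqF.
  rewrite EFinM; over.
have c0 : 0 <= s * expR (b ^+ 2 / 2 / (1 + p)) by rewrite mulr_ge0 ?expR_ge0// ltW.
rewrite ge0_integralZl_EFin// ?integral_normal_pdf ?mule1//.
- by move=> x _; rewrite lee_fin normal_pdf_ge0.
- exact: measurable_normal_pdf_EFin.
Qed.

(** One-dimensional Cameron-Martin formula: the exponential weight turns the standard density at [x]
    into the standard density at [a + x], and Lebesgue measure is translation invariant. *)
Lemma normal_shift (a : R) (g : R -> \bar R) :
  measurable_fun setT g -> (forall x, (0 <= g x)%E) ->
  (\int[normal_prob 0 1]_x (g (a + x)%R * (expR (- a * x - a ^+ 2 / 2))%:E) =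
   \int[normal_prob 0 1]_x g x)%E.
Proof.
move=> mg g0; rewrite !ge0_integral_normal//; last 2 first.
- apply: emeasurable_funM.
    apply: measurableT_comp => //; exact: measurable_funD.
  apply/measurable_EFinP; apply: measurableT_comp => //.
  by apply: measurable_funB => //; exact: measurable_funM.
- by move=> x; rewrite mule_ge0// lee_fin expR_ge0.
rewrite -[RHS](ge0_integral_shift a); last 2 first.
- apply: emeasurable_funM => //.
  exact: measurable_normal_pdf_EFin.
- by move=> x; rewrite mule_ge0// lee_fin normal_pdf_ge0.
apply: eq_integral => x _; rewrite -muleA -EFinM; congr (_ * _%:E)%E.
rewrite !normal_pdf_expR ?oner_neq0// mulrCA -expRD.
by congr (_ * expR _); field.
Qed.

End normal_integrals.

(** * Moment generating functions *)

Section nonneg_power_series.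
Context {R : realType}.
Implicit Types a b u : nat -> R.

Lemma nneseries_EFin u (l : R) : series u @ \oo --> l ->
  (\sum_(k <oo) (u k)%:E = l%:E)%E.
Proof.
move=> ul; apply/cvg_lim => //.
rewrite (_ : (fun n => _) = EFin \o series u); first by apply: cvg_EFin => //; exact: nearW.
by apply/funext => n /=; rewrite sumEFin.
Qed.

(** The partial sum of the first series is at most the whole second series, whose tail beyond [n] is
    at most [z ^+ n.+1 * C]. Cancelling the common terms and dividing by [z ^+ n] leaves
    [a n <= b n + z * C], with [z] arbitrarily small. *)
Lemma nneseries_coef_le a b n :
  (forall k, 0 <= a k) -> (forall k, 0 <= b k) ->
  (\sum_(k <oo) (b k)%:E < +oo)%E ->
  (forall z, 0 <= z <= 1 ->
    (\sum_(k <oo) (a k * z ^+ k)%:E = \sum_(k <oo) (b k * z ^+ k)%:E)%E) ->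
  (forall k, (k < n)%N -> a k = b k) -> a n <= b n.
Proof.
move=> a0 b0 bfin ab abn.
have Sb0 : (0 <= \sum_(k <oo) (b k)%:E)%E.
  by apply: nneseries_ge0 => k _ _; rewrite lee_fin.
pose C := fine (\sum_(k <oo) (b k)%:E)%E.
have CE : (\sum_(k <oo) (b k)%:E = C%:E)%E by rewrite fineK// ge0_fin_numE.
have C0 : 0 <= C by exact: fine_ge0.
have C1 : 0 < C + 1 by rewrite ltr_wpDl.
apply/ler_addgt0Pr => e e0.
(* Small enough for [z * C <= e]; the denominator is [C + 1] because [C] may vanish. *)
pose z := Num.min 1 (e / (C + 1)).
have z0 : 0 < z by rewrite lt_min ltr01 divr_gt0.
have z1 : z <= 1 by rewrite ge_min lexx.
have zC : z * C <= e.
  apply: (@le_trans _ _ (e / (C + 1) * C)).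
    by rewrite ler_wpM2r// ge_min lexx orbT.
  rewrite mulrAC ler_pdivrMr// ler_wpM2l ?(ltW e0)//.
  by rewrite lerDl.
have part N : \sum_(0 <= k < N) b k * z ^+ k <=
    \sum_(0 <= k < n.+1) b k * z ^+ k + z ^+ n.+1 * C.
  have psum M : \sum_(0 <= k < M) b k <= C.
    rewrite -lee_fin -CE -sumEFin.
    apply: nneseries_lim_ge => k _ _; by rewrite lee_fin.
  have [Nn|nN] := leqP N n.+1.
    rewrite [leRHS](_ : _ = \sum_(0 <= k < N) b k * z ^+ k +
      (\sum_(N <= k < n.+1) b k * z ^+ k + z ^+ n.+1 * C)); last first.
      by rewrite addrA -big_cat_nat.
    rewrite lerDl addr_ge0//.
      by apply: sumr_ge0 => k _; rewrite mulr_ge0// exprn_ge0// ltW.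
    by rewrite mulr_ge0// exprn_ge0// ltW.
  rewrite (@big_cat_nat _ _ _ n.+1)//= ?(ltnW nN)// lerD2l.
  apply: (@le_trans _ _ (z ^+ n.+1 * \sum_(n.+1 <= k < N) b k)); last first.
    rewrite ler_wpM2l ?exprn_ge0 ?(ltW z0)//.
    apply: le_trans (psum N).
    rewrite [leRHS](@big_cat_nat _ _ _ n.+1)//= ?(ltnW nN)// lerDr.
    exact: sumr_ge0.
  rewrite big_distrr/= big_nat [leRHS]big_nat; apply: ler_sum => k /andP[nk _].
  rewrite mulrC ler_wpM2r// -(subnKC nk) exprD ler_piMr ?exprn_ge0 ?(ltW z0)//.
  by rewrite exprn_ile1// ltW.
have : (\sum_(0 <= k < n.+1) (a k * z ^+ k)%:E <=
        (\sum_(0 <= k < n.+1) b k * z ^+ k + z ^+ n.+1 * C)%:E)%E.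
  apply: (@le_trans _ _ (\sum_(k <oo) (a k * z ^+ k)%:E)%E).
    apply: nneseries_lim_ge => k _ _.
    by rewrite lee_fin mulr_ge0// exprn_ge0// ltW.
  rewrite ab ?(ltW z0)//; apply: lime_le.
    apply: is_cvg_nneseries => k _ _.
    by rewrite lee_fin mulr_ge0// exprn_ge0// ltW.
  by apply: nearW => N; rewrite sumEFin lee_fin.
rewrite sumEFin lee_fin !big_nat_recr//= -addrA.
rewrite (@eq_big_nat _ _ _ _ _ _ (fun k => b k * z ^+ k)); last first.
  by move=> k /andP[_ kn]; rewrite abn.
rewrite lerD2l => abz.
have zn : 0 < z ^+ n by rewrite exprn_gt0.
rewrite -(ler_pM2r zn) (le_trans abz)// mulrDl lerD2l exprSr -mulrA mulrC.
by rewrite ler_wpM2r// ltW.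
Qed.

Lemma nneseries_coef_inj a b :
  (forall k, 0 <= a k) -> (forall k, 0 <= b k) ->
  (\sum_(k <oo) (b k)%:E < +oo)%E ->
  (forall z, 0 <= z <= 1 ->
    (\sum_(k <oo) (a k * z ^+ k)%:E = \sum_(k <oo) (b k * z ^+ k)%:E)%E) ->
  a =1 b.
Proof.
move=> a0 b0 bfin ab n; elim/ltn_ind: n => n IH.
(* The two series agree at [z = 1], so [a] is summable too and the roles of [a] and [b] can be
   exchanged. *)
have afin : (\sum_(k <oo) (a k)%:E < +oo)%E.
  have := ab 1; rewrite ler01 lexx => /(_ isT).
  have E1 (c : nat -> R) :
      (\sum_(k <oo) (c k * 1 ^+ k)%:E = \sum_(k <oo) (c k)%:E)%E.
    by apply: eq_eseriesr => k _; rewrite expr1n mulr1.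
  by rewrite !E1 => ->.
apply/eqP; rewrite eq_le !nneseries_coef_le//.
  by move=> z z01; rewrite ab.
by move=> k /IH.
Qed.

End nonneg_power_series.

(** * The power series of the hyperbolic cosine *)

Section cosh.
Context {R : realType}.
Implicit Types y : R.

Definition cosh_coeff y (n : nat) : R := y ^+ n.*2 / n.*2`!%:R.

Lemma cosh_coeff_ge0 y n : 0 <= cosh_coeff y n.
Proof. by rewrite divr_ge0// -mul2n exprM exprn_ge0 ?sqr_ge0. Qed.

(** The exponential series at [y] and [- y] are averaged and their terms grouped two by two; in each
    group the odd term cancels. *)
Lemma cvg_cosh_coeff y :
  series (cosh_coeff y) @ \oo --> (expR y + expR (- y)) / 2.
Proof.
pose c (n : nat) : R := (exp_coeff y n + exp_coeff (- y) n) / 2.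
have cE : series c = (fun n => (series (exp_coeff y) n +
    series (exp_coeff (- y)) n) / 2).
  by apply/funext => n; rewrite /series/= /c -mulr_suml big_split.
have cc : series c @ \oo --> (expR y + expR (- y)) / 2.
  rewrite cE; apply: cvgMl; apply: cvgD;
    exact: is_cvg_series_exp_coeff.
have cvgc : cvgn (series c) by apply/cvg_ex; eexists; exact: cc.
have := @cvg_series_cvg_series_group _ c 2 cvgc isT.
rewrite (cvg_lim _ cc)//.
rewrite [X in series X @ \oo --> _](_ : _ = cosh_coeff y)//.
apply/funext => n; rewrite /= 2!muln2 doubleS big_nat_recr//= big_nat_recr//=.
rewrite big_geq// add0r /c /cosh_coeff /exp_coeff /=.
rewrite !(exprNn y) -(signr_odd _ n.*2) -(signr_odd _ n.*2.+1) /= odd_double/=.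
rewrite expr0 expr1; field.
by rewrite !pnatr_eq0 -!lt0n !fact_gt0.
Qed.

End cosh.

(** * Centred Gaussian variables under a weight [g] of total mass [N], given by their moment
    generating function *)

Section gaussian_mgf.
Context {d : measure_display} {T : measurableType d} {R : realType}.
Variables (P : probability T R) (g x : T -> R) (N v : R).
Hypotheses (mg : measurable_fun setT g) (mx : measurable_fun setT x).
Hypotheses (g0 : forall w, 0 <= g w) (N0 : 0 <= N) (v0 : 0 <= v).
Hypothesis mgf : forall u, (\int[P]_w (g w * expR (u * x w))%:E =
  (N * expR (u ^+ 2 * v / 2))%:E)%E.

Let mcoef k t : measurable_fun setT (fun w => (g w * cosh_coeff (t * x w) k)%:E).
Proof.
apply/measurable_EFinP; apply: measurable_funM => //.
by apply: measurable_funM => //; apply: measurable_funX; exact: measurable_funM.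
Qed.

(** The moment of order [2 k] of [x] under the weight [g], divided by the factorial of [2 k]. *)
Let M k := (\int[P]_w (g w * cosh_coeff (x w) k)%:E)%E.

Let M0 k : (0 <= M k)%E.
Proof.
by apply: integral_ge0 => w _; rewrite lee_fin mulr_ge0// cosh_coeff_ge0.
Qed.

Let integral_coef k t :
  (\int[P]_w (g w * cosh_coeff (t * x w) k)%:E = M k * (t ^+ 2 ^+ k)%:E)%E.
Proof.
under eq_integral => w _.
  rewrite (_ : g w * _ = g w * cosh_coeff (x w) k * t ^+ 2 ^+ k); last first.
    by rewrite /cosh_coeff exprMn -exprM mul2n; ring.
  rewrite EFinM; over.
rewrite ge0_integralZr//.
- by have := mcoef k 1; under eq_fun do rewrite mul1r.
- by move=> w _; rewrite lee_fin mulr_ge0// cosh_coeff_ge0.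
- by rewrite lee_fin exprn_ge0// sqr_ge0.
Qed.

(** Since [c], [g] and the terms of the cosh series are nonnegative, sum and integral are exchanged
    by monotone convergence. *)
Let integral_series (c : nat -> R) t (f : T -> R) :
  (forall k, 0 <= c k) ->
  (forall w, series (fun k => c k * cosh_coeff (t * x w) k) @ \oo --> f w) ->
  (\int[P]_w (g w * f w)%:E = \sum_(k <oo) (M k * (c k * t ^+ 2 ^+ k)%:E))%E.
Proof.
move=> c0 cf.
transitivity (\int[P]_w \sum_(k <oo) ((c k)%:E *
    (g w * cosh_coeff (t * x w) k)%:E))%E.
  apply: eq_integral => w _; apply/esym.
  under eq_eseriesr do rewrite -EFinM mulrCA.
  apply: nneseries_EFin.
  rewrite (_ : series _ = fun n => g w *
      series (fun k => c k * cosh_coeff (t * x w) k) n).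
    exact: cvgMr.
  by apply/funext => n; rewrite /series/= mulr_sumr.
rewrite integral_nneseries//; last 2 first.
- by move=> k; apply: emeasurable_funM => //; exact: mcoef.
- by move=> k w _; rewrite mule_ge0// lee_fin// mulr_ge0// cosh_coeff_ge0.
apply: eq_eseriesr => k _; rewrite ge0_integralZl_EFin//.
- by rewrite integral_coef EFinM muleCA.
- by move=> w _; rewrite lee_fin mulr_ge0// cosh_coeff_ge0.
Qed.

Let integral_cosh t :
  (\int[P]_w (g w * ((expR (t * x w) + expR (- (t * x w))) / 2))%:E =
   (N * expR (t ^+ 2 * v / 2))%:E)%E.
Proof.
transitivity (\int[P]_w (2^-1%:E * (g w * expR (t * x w))%:E +
                         2^-1%:E * (g w * expR (- t * x w))%:E))%E.
  apply: eq_integral => w _; rewrite -!EFinM -EFinD mulNr; congr (_%:E).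
  by rewrite -[expR _ + _]/(_ + _); field.
have mexp u : measurable_fun setT (fun w => (g w * expR (u * x w))%:E).
  apply/measurable_EFinP; apply: measurable_funM => //.
  by apply: measurableT_comp => //; exact: measurable_funM.
have pexp u w : (0 <= (g w * expR (u * x w))%:E)%E.
  by rewrite lee_fin mulr_ge0// expR_ge0.
rewrite ge0_integralD//; first last.
- by apply: emeasurable_funM => //; exact: mexp.
- by move=> w _; rewrite mule_ge0.
- by apply: emeasurable_funM => //; exact: mexp.
- by move=> w _; rewrite mule_ge0.
rewrite !ge0_integralZl_EFin// ?invr_ge0//.
by rewrite !mgf sqrrN -!EFinM -EFinD; congr (_%:E); field.
Qed.

(* Both sides of [int g cosh (t x) = N exp (t^2 v / 2)] are power series in
   [t^2] with nonnegative coefficients. *)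
Lemma even_moments k : M k = (N * (v / 2) ^+ k / k`!%:R)%:E.
Proof.
have sumM t : (\sum_(k <oo) (M k * (t ^+ 2 ^+ k)%:E) =
    (N * expR (t ^+ 2 * v / 2))%:E)%E.
  rewrite -integral_cosh (@integral_series (fun=> 1) t)//.
    by apply: eq_eseriesr => i _; rewrite mul1r.
  by move=> w; under eq_fun do rewrite mul1r; exact: cvg_cosh_coeff.
have Mfin i : M i \is a fin_num.
  rewrite ge0_fin_numE//; apply: le_lt_trans (ltry (N * expR (1 ^+ 2 * v / 2))).
  rewrite -(sumM 1); apply: le_trans (nneseries_lim_ge i.+1 _).
    rewrite big_nat_recr//= !expr1n mule1 leeDr// sume_ge0// => j _.
    by rewrite expr1n mule1.
  by move=> j _ _; rewrite !expr1n mule1.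
(* The coefficients of [N * expR (z * v / 2)] as a power series in [z]; the comparison is then made
   at [z = t ^+ 2] with [t] the square root of [z]. *)
pose b i := N * (v / 2) ^+ i / i`!%:R.
have b0 i : 0 <= b i by rewrite divr_ge0// mulr_ge0// exprn_ge0// divr_ge0.
have bs z : (\sum_(i <oo) (b i * z ^+ i)%:E = (N * expR (z * v / 2))%:E)%E.
  apply: nneseries_EFin.
  rewrite (_ : series _ = fun n => N * series (exp_coeff (z * v / 2)) n).
    by apply: cvgMr; exact: is_cvg_series_exp_coeff.
  apply/funext => n; rewrite /series/= mulr_sumr; apply: eq_bigr => i _.
  by rewrite /b /exp_coeff/= -[z * v / 2]mulrA (exprMn i z); ring.
rewrite -(fineK (Mfin k)); congr (_%:E).
apply: (@nneseries_coef_inj _ (fine \o M) b) => //.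
- by move=> i; exact: fine_ge0.
- have := bs 1; under eq_eseriesr do rewrite expr1n mulr1.
  by move=> ->; rewrite ltry.
- move=> z /andP[z0 z1]; rewrite bs -{2}(sqr_sqrtr z0) -sumM.
  by apply: eq_eseriesr => i _; rewrite sqr_sqrtr// EFinM fineK.
Qed.

(* [cosh + cos] has a power series with nonnegative coefficients, so that it can
   be integrated term by term without any domination argument. *)
Lemma gaussian_mgf_cos t : (\int[P]_w (g w * (1 + cos (t * x w)))%:E =
  (N * (1 + expR (- (t ^+ 2 * v / 2))))%:E)%E.
Proof.
pose ch w := (expR (t * x w) + expR (- (t * x w))) / 2.
have mtx : measurable_fun setT (fun w => t * x w) by exact: measurable_funM.
have mcos : measurable_fun setT (fun w => cos (t * x w)).
  apply: measurableT_comp => //.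
  by apply: continuous_measurable_fun; exact: continuous_cos.
have ch0 w : 0 <= ch w by rewrite divr_ge0// addr_ge0// expR_ge0.
have mch : measurable_fun setT ch.
  apply: measurable_funM => //; apply: measurable_funD;
    apply: measurableT_comp => //; exact: measurableT_comp.
have cos0 w : 0 <= 1 + cos (t * x w) by rewrite -lerBlDl sub0r cos_geN1.
have chcos0 w : 0 <= ch w + cos (t * x w).
  have /le_trans : 0 <= 1 + cos (t * x w) by []. apply.
  rewrite lerD2r ler_pdivlMr// mul1r.
  have := lerD (expR_ge1Dx (t * x w)) (expR_ge1Dx (- (t * x w))).
  by apply: le_trans; rewrite addrACA subrr addr0.
have chcos : (\int[P]_w (g w * (ch w + cos (t * x w)))%:E =
    (N * (expR (t ^+ 2 * v / 2) + expR (- (t ^+ 2 * v / 2))))%:E)%E.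
  (* The cosine series is the cosh series with alternating signs, so the sum has coefficients 0 or 2
     times those of cosh. *)
  rewrite (@integral_series (fun k => 1 + (-1) ^+ k) t); first last.
  - move=> w.
    rewrite (_ : series _ = fun n => series (cosh_coeff (t * x w)) n +
        series (cos_coeff' (t * x w)) n).
      by apply: cvgD; [exact: cvg_cosh_coeff|exact: cvg_cos_coeff'].
    apply/funext => n; rewrite /series/= -big_split/=; apply: eq_bigr => k _.
    by rewrite mulrDl mul1r /cos_coeff' -exprnP /cosh_coeff mulrA.
  - by move=> k; rewrite -signr_odd; case: odd; rewrite ?subrr// addr_ge0.
  under eq_eseriesr do rewrite even_moments -EFinM.
  apply: nneseries_EFin.
  set y := t ^+ 2 * v / 2.
  rewrite (_ : series _ = fun n => N * (series (exp_coeff y) n +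
      series (exp_coeff (- y)) n)).
    by apply: cvgMr; apply: cvgD; exact: is_cvg_series_exp_coeff.
  apply/funext => n; rewrite /series/= -big_split/= mulr_sumr.
  apply: eq_bigr => k _; rewrite /exp_coeff/= (exprNn y).
  have -> : y = t ^+ 2 * (v / 2) by rewrite /y mulrA.
  rewrite (exprMn k (t ^+ 2)); field.
  by rewrite pnatr_eq0 -lt0n fact_gt0.
have int1 : (\int[P]_w (g w)%:E = N%:E)%E.
  have := mgf 0; rewrite expr0n/= !mul0r expR0 mulr1 => <-.
  by apply: eq_integral => w _; rewrite mul0r expR0 mulr1.
have mE f : measurable_fun setT f -> measurable_fun setT (fun w => (g w * f w)%:E).
  by move=> mf; apply/measurable_EFinP; exact: measurable_funM.
have pE f : (forall w, 0 <= f w) -> forall w, setT w -> (0 <= (g w * f w)%:E)%E.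
  by move=> f0 w _; rewrite lee_fin mulr_ge0.
(* The cosh integral is added rather than subtracted, so that only integrals of nonnegative
   functions occur; it is finite and is cancelled at the end. *)
have : (\int[P]_w (g w * (1 + cos (t * x w)))%:E + (N * expR (t ^+ 2 * v / 2))%:E
    = (N * (expR (t ^+ 2 * v / 2) + expR (- (t ^+ 2 * v / 2))))%:E + N%:E)%E.
  rewrite -integral_cosh -chcos -int1 -!ge0_integralD//.
  - by apply: eq_integral => w _; rewrite -!EFinD /ch; congr (_%:E); ring.
  - exact: pE.
  - by apply: mE; exact: measurable_funD.
  - by move=> w _; rewrite lee_fin.
  - exact/measurable_EFinP.
  - by apply: pE => w; exact: cos0.
  - by apply: mE; exact: measurable_funD.
  - exact: pE.
  - exact: mE.
move/(congr1 (fun z => z - (N * expR (t ^+ 2 * v / 2))%:E)%E).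
rewrite addeK// => -> /=; congr (_%:E); ring.
Qed.

End gaussian_mgf.

Lemma measurable_EFin_measurableTypeR (R : realType) (f : R -> R) :
  measurable_fun setT f ->
  measurable_fun [set: measurableTypeR R] (fun y => (f y)%:E).
Proof. by move=> mf; apply/measurable_EFinP. Qed.

(** * Quadratic exponential weights of one Gaussian variable *)

Section gaussian_quadratic.
Context {d : measure_display} {T : measurableType d} {R : realType}.
Variables (P : probability T R).
Local Notation gam := (@normal_prob R 0 1).

Lemma normal_cos t : (\int[gam]_y (1 + cos (t * y))%:E =
  (1 + expR (- (t ^+ 2 / 2)))%:E)%E.
Proof.
have := @gaussian_mgf_cos _ _ _ gam (fun=> 1) id 1 1 _ _ _ _ _ _ t.
rewrite mulr1 mul1r => <- //.
- by apply: eq_integral => y _; rewrite mul1r.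
- move=> u; under eq_integral do rewrite mul1r.
  by rewrite normal_mgf ?oner_neq0// expr1n mulr1 mulr0 add0r mul1r.
Qed.

(** An auxiliary standard normal [y] linearises the square: averaging [expR (t * x * y)] over [y]
    gives the weight when [t ^+ 2 = - S], and averaging [cos (t * x * y)] gives it when
    [t ^+ 2 = S]. After Tonelli, the integral over [w] is known and leaves a Gaussian integral in
    [y], finite because [0 < 1 + S * v]. *)
Lemma gaussian_mgf_quadratic_centered (g x : T -> R) (N v S : R) :
  measurable_fun setT g -> measurable_fun setT x ->
  (forall w, 0 <= g w) -> 0 <= N -> 0 <= v ->
  (forall u, (\int[P]_w (g w * expR (u * x w))%:E =
    (N * expR (u ^+ 2 * v / 2))%:E)%E) ->
  0 < 1 + S * v ->
  (\int[P]_w (g w * expR (- (S / 2 * x w ^+ 2)))%:E =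
   (N / Num.sqrt (1 + S * v))%:E)%E.
Proof.
move=> mg mx g0 N0 v0 mgf Sv.
have mxw t : measurable_fun [set: T * measurableTypeR R]
    (fun z => t * x z.1 * z.2).
  apply: measurable_funM => //; apply: measurable_funM => //.
  exact: (measurableT_comp mx).
have mg1 : measurable_fun [set: T * measurableTypeR R] (fun z => g z.1).
  exact: (measurableT_comp mg).
have [S0|S0] := leP S 0.
- pose t := Num.sqrt (- S).
  have tE : t ^+ 2 = - S by rewrite sqr_sqrtr// oppr_ge0.
  transitivity (\int[P]_w \int[gam]_y (g w * expR (t * x w * y))%:E)%E.
    apply: eq_integral => w _; under eq_integral do rewrite EFinM.
    rewrite ge0_integralZl_EFin//; last first.
      by apply: measurable_EFin_measurableTypeR; apply: measurableT_comp.
    rewrite normal_mgf ?oner_neq0// expr1n mulr1 mulr0 add0r -EFinM.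
    by rewrite exprMn tE; congr (_ * expR _)%:E; ring.
  transitivity (\int[gam]_y \int[P]_w (g w * expR (t * x w * y))%:E)%E.
    apply: (fubini_tonelli (m1 := P) (m2 := gam)
      (fun z : T * measurableTypeR R => (g z.1 * expR (t * x z.1 * z.2))%:E)).
    - apply/measurable_EFinP; apply: measurable_funM => //.
      exact: measurableT_comp.
    - by move=> z; rewrite lee_fin mulr_ge0// expR_ge0.
  transitivity (\int[gam]_y (N%:E * (expR (0 * y - (S * v) / 2 * y ^+ 2))%:E))%E.
    apply: eq_integral => y _.
    under eq_integral do rewrite (mulrAC t).
    rewrite mgf EFinM exprMn tE; congr (_ * (expR _)%:E)%E.
    by ring.
  rewrite ge0_integralZl_EFin//; last first.
  - apply: measurable_EFin_measurableTypeR; apply: measurableT_comp => //.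
    by apply: measurable_funB; apply: measurable_funM => //; exact: measurable_funX.
  by rewrite normal_exp_quadratic// expr0n/= !mul0r expR0 mulr1.
- pose t := Num.sqrt S.
  have tE : t ^+ 2 = S by rewrite sqr_sqrtr// ltW.
  have mcos : measurable_fun setT (@cos R).
    by apply: continuous_measurable_fun; exact: continuous_cos.
  have cos0 y : 0 <= 1 + cos y :> R by rewrite -lerBlDl sub0r cos_geN1.
  have mq : measurable_fun setT (fun w => expR (- (S / 2 * x w ^+ 2))).
    apply: measurableT_comp => //; apply: measurableT_comp => //.
    by apply: measurable_funM => //; exact: measurable_funX.
  have int1 : (\int[P]_w (g w)%:E = N%:E)%E.
    have := mgf 0; rewrite expr0n/= !mul0r expR0 mulr1 => <-.
    by apply: eq_integral => w _; rewrite mul0r expR0 mulr1.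
  (* The constant 1 makes the integrand [1 + cos] nonnegative, as Tonelli requires; its contribution
     [N] is subtracted afterwards. *)
  have : (\int[P]_w (g w * (1 + expR (- (S / 2 * x w ^+ 2))))%:E =
      (N * (1 + (Num.sqrt (1 + S * v))^-1))%:E)%E.
    transitivity (\int[P]_w \int[gam]_y (g w * (1 + cos (t * x w * y)))%:E)%E.
      apply: eq_integral => w _; under [RHS]eq_integral do rewrite EFinM.
      rewrite ge0_integralZl_EFin//; last first.
        apply: measurable_EFin_measurableTypeR; apply: measurable_funD => //.
        exact: measurableT_comp.
      rewrite normal_cos -EFinM exprMn tE.
      by congr (_ * (1 + expR _))%:E; ring.
    transitivity (\int[gam]_y \int[P]_w (g w * (1 + cos (t * x w * y)))%:E)%E.
      apply: (fubini_tonelli (m1 := P) (m2 := gam) (fun z : T * measurableTypeR R =>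
        (g z.1 * (1 + cos (t * x z.1 * z.2)))%:E)).
      - apply/measurable_EFinP; apply: measurable_funM => //.
        apply: measurable_funD => //.
        exact: measurableT_comp.
      - by move=> z; rewrite lee_fin mulr_ge0.
    transitivity (\int[gam]_y (N%:E * (1 +
        (expR (0 * y - (S * v) / 2 * y ^+ 2)))%:E))%E.
      apply: eq_integral => y _.
      under eq_integral do rewrite (mulrAC t).
      rewrite (gaussian_mgf_cos P _ _ _ _ mg mx g0 N0 v0 mgf) EFinM exprMn tE.
      by congr (_ * (1 + expR _)%:E)%E; ring.
    have mqv : measurable_fun [set: measurableTypeR R]
        (fun y => (expR (0 * y - (S * v) / 2 * y ^+ 2))%:E).
      apply: measurable_EFin_measurableTypeR; apply: measurableT_comp => //.
      by apply: measurable_funB; apply: measurable_funM => //; exact: measurable_funX.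
    rewrite ge0_integralZl_EFin//; last first.
      by under eq_fun do rewrite EFinD; apply: emeasurable_funD.
    under eq_integral do rewrite EFinD.
    rewrite ge0_integralD//.
    rewrite normal_exp_quadratic// expr0n/= !mul0r expR0 mulr1.
    have -> : (\int[gam]_y 1%:E = 1%:E)%E.
      by rewrite integral_cst// mul1e; exact: (@probability_setT _ _ _ gam).
    by rewrite -?EFinD -?EFinM.
  under eq_integral do rewrite mulrDr mulr1 EFinD.
  rewrite ge0_integralD; [|exact: measurableT| | | |].
  2: by move=> w _; rewrite lee_fin.
  2: exact/measurable_EFinP.
  2: by move=> w _; rewrite lee_fin mulr_ge0// expR_ge0.
  2: by apply/measurable_EFinP; exact: measurable_funM.
  rewrite int1 addeC => /(congr1 (fun z => z - N%:E)%E).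
  rewrite addeK// => -> /=; congr (_%:E); ring.
Qed.

(* Tilting by [exp (b x)] moves the mean [a] to [a + b v]; [b] is chosen so
   that the remaining quadratic form is centred at the new mean. *)
Lemma gaussian_mgf_quadratic (g x : T -> R) (N a v S B : R) :
  measurable_fun setT g -> measurable_fun setT x ->
  (forall w, 0 <= g w) -> 0 <= N -> 0 <= v ->
  (forall u, (\int[P]_w (g w * expR (u * x w))%:E =
    (N * expR (u * a + u ^+ 2 * v / 2))%:E)%E) ->
  0 < 1 + S * v ->
  (\int[P]_w (g w * expR (B * x w - S / 2 * x w ^+ 2))%:E =
   (N / Num.sqrt (1 + S * v) *
    expR ((B * a + B ^+ 2 * v / 2 - S / 2 * a ^+ 2) / (1 + S * v)))%:E)%E.
Proof.
move=> mg mx g0 N0 v0 mgf Sv.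
pose b := (B - S * a) / (1 + S * v); pose a' := a + b * v.
have mbx : measurable_fun setT (fun w => b * x w) by exact: measurable_funM.
have mx' : measurable_fun setT (fun w => x w - a') by exact: measurable_funB.
have Sv0 : 1 + S * v != 0 by rewrite gt_eqF.
(* Expanding the square centred at [a'], one has [b + S * a' = B]; the two integrands then differ by
   the constant factor [C]. *)
pose C := expR (- (S / 2 * a' ^+ 2)).
have C0 : 0 < C by exact: expR_gt0.
have H := @gaussian_mgf_quadratic_centered (fun w => g w * expR (b * x w))
  (fun w => x w - a') (N * expR (b * a + b ^+ 2 * v / 2)) v S.
have {}H : (\int[P]_w (C%:E * (g w * expR (B * x w - S / 2 * x w ^+ 2))%:E) =
    (N * expR (b * a + b ^+ 2 * v / 2) / Num.sqrt (1 + S * v))%:E)%E.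
  rewrite -H//.
  - apply: eq_integral => w _; rewrite -EFinM mulrCA -!mulrA -!expRD.
    by congr (_ * expR _)%:E; rewrite /a' /b; field.
  - by apply: measurable_funM => //; exact: measurableT_comp.
  - by move=> w; rewrite mulr_ge0// expR_ge0.
  - by rewrite mulr_ge0// expR_ge0.
  - move=> u.
    transitivity (\int[P]_w ((expR (- (u * a')))%:E *
        (g w * expR ((b + u) * x w))%:E))%E.
      apply: eq_integral => w _; rewrite -EFinM mulrCA -(mulrA (g w)) -!expRD.
      by congr (_ * expR _)%:E; ring.
    rewrite ge0_integralZl_EFin ?expR_ge0//; last 2 first.
    - by move=> w _; rewrite lee_fin mulr_ge0// expR_ge0.
    - apply/measurable_EFinP; apply: measurable_funM => //.
      by apply: measurableT_comp => //; exact: measurable_funM.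
    rewrite mgf -EFinM mulrCA -(mulrA N) -!expRD; congr (_ * expR _)%:E.
    by rewrite /a'; field.
move: H; rewrite ge0_integralZl_EFin ?(ltW C0)//; last 2 first.
- by move=> w _; rewrite lee_fin mulr_ge0// expR_ge0.
- apply/measurable_EFinP; apply: measurable_funM => //.
  apply: measurableT_comp => //; apply: measurable_funB.
    exact: measurable_funM.
  by apply: measurable_funM => //; exact: measurable_funX.
move/(congr1 (fun z => (C^-1)%:E * z)%E).
rewrite muleA -!EFinM mulVf ?gt_eqF// mul1e => ->; congr (_%:E).
rewrite /C -expRN opprK.
transitivity (N / Num.sqrt (1 + S * v) *
    (expR (S / 2 * a' ^+ 2) * expR (b * a + b ^+ 2 * v / 2))); first by ring.
by rewrite -expRD; congr (_ * expR _); rewrite /a' /b; field.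
Qed.

End gaussian_quadratic.

(** * Gaussian sequences *)

Section second_moments.
Context {d : measure_display} {T : measurableType d} {R : realType}.
Variable P : probability T R.

Lemma Lfun2_sqr (f : T -> R) : measurable_fun setT f ->
  (\int[P]_w (f w ^+ 2)%:E < +oo)%E -> f \in Lfun P 2%:E.
Proof.
move=> mf foo; rewrite inE; apply/andP; split; rewrite inE//=.
rewrite /finite_norm unlock /Lnorm; apply: poweR_lty.
apply: le_lt_trans foo; rewrite le_eqVlt; apply/orP; left; apply/eqP.
apply: eq_integral => w _ /=.
by rewrite powR_mulrn// real_normK// num_real.
Qed.

Variables (Z : nat -> T -> R) (c : nat -> R).
Hypothesis Z2 : forall t, (1 <= t)%N -> Z t \in Lfun P 2%:E.

Let Pfin : P setT \is a fin_num := fin_num_measure P _ measurableT.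

Lemma Lfun2_sum n :
  (fun w => \sum_(1 <= t < n.+1) c t * Z t w) \in Lfun P 2%:E.
Proof.
elim: n => [|n IH].
  rewrite (_ : (fun w => _) = cst 0) ?Lfun_cst//.
  by apply/funext => w; rewrite big_geq.
rewrite (_ : (fun w => _) = (fun w => \sum_(1 <= t < n.+1) c t * Z t w) \+
    (c n.+1 \o* Z n.+1)).
  by rewrite rpredD ?lee1n//= Lfun_scale ?ler1n// Z2.
by apply/funext => w; rewrite big_nat_recr//= [in RHS]mulrC.
Qed.

Lemma expectation_lincomb n :
  'E_P[(fun w => \sum_(1 <= t < n.+1) c t * Z t w)%R]%E =
  (\sum_(1 <= t < n.+1) (c t)%:E * 'E_P[Z t])%E.
Proof.
elim: n => [|n IH].
  rewrite big_geq// (_ : (fun w => _) = cst 0) ?expectation_cst//.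
  by apply/funext => w; rewrite big_geq.
rewrite (_ : (fun w => _) = (fun w => \sum_(1 <= t < n.+1) c t * Z t w) \+
    (c n.+1 \o* Z n.+1)); last first.
  by apply/funext => w; rewrite big_nat_recr//= [in RHS]mulrC.
have Zn1 : Z n.+1 \in Lfun P 1 by apply: Lfun_subset12 => //; exact: Z2.
rewrite expectationD; last 2 first.
- by apply: Lfun_subset12 => //; exact: Lfun2_sum.
- by rewrite Lfun_scale.
by rewrite IH expectationZl// [RHS]big_nat_recr.
Qed.

Lemma covariance_lincombl (Y : T -> R) n : Y \in Lfun P 2%:E ->
  covariance P (fun w => \sum_(1 <= t < n.+1) c t * Z t w) Y =
  (\sum_(1 <= t < n.+1) (c t)%:E * covariance P (Z t) Y)%E.
Proof.
move=> Y2; elim: n => [|n IH].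
  rewrite big_geq// (_ : (fun w => _) = cst 0) ?covariance_cst_l//.
  by apply/funext => w; rewrite big_geq.
rewrite (_ : (fun w => _) = (fun w => \sum_(1 <= t < n.+1) c t * Z t w) \+
    (c n.+1 \o* Z n.+1)); last first.
  by apply/funext => w; rewrite big_nat_recr//= [in RHS]mulrC.
rewrite covarianceDl//; last 2 first.
- exact: Lfun2_sum.
- by rewrite Lfun_scale ?ler1n// Z2.
rewrite IH covarianceZl//; last 3 first.
- by apply: Lfun_subset12 => //; exact: Z2.
- exact: Lfun_subset12.
- by apply: Lfun2_mul_Lfun1 => //; exact: Z2.
by rewrite [RHS]big_nat_recr.
Qed.

End second_moments.

(** * From a Gaussian law to its moment generating function *)

Section gaussian_moments.
Context {d : measure_display} {T : measurableType d} {R : realType}.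
Variable P : probability T R.
Variable Z : T -> R.
Hypothesis mZ : measurable_fun setT Z.

Lemma ge0_integral_law (nu : {measure set (measurableTypeR R) -> \bar R}) (f : R -> \bar R) :
  (forall B, measurable B -> P (Z @^-1` B) = nu B) ->
  measurable_fun setT f -> (forall y, (0 <= f y)%E) ->
  (\int[P]_w f (Z w) = \int[nu]_y f y)%E.
Proof.
move=> ZE mf f0.
pose Z' : T -> measurableTypeR R := Z.
transitivity (\int[pushforward P Z']_y f y)%E.
  by rewrite ge0_integral_pushforward//= preimage_setT.
by apply: eq_measure_integral => // B mB _; exact: ZE.
Qed.

(* [1 + u W <= exp (u W)] integrates to [1 + u E W <= exp (u^2 c)], whose first
   order expansion at [u = 0] forces [E W = 0]. *)
Lemma centered_of_exp_bound (a c : R) : 0 <= c ->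
  (forall u, 1 + u * a <= expR (u ^+ 2 * c)) -> a = 0.
Proof.
move=> c0 H; apply/eqP/negP => /negP a0.
have a2 : 0 < a ^+ 2 by rewrite exprn_even_gt0.
pose D := c + a ^+ 2 * c + 1.
have D1 : 1 <= D by rewrite lerDr addr_ge0// mulr_ge0// ltW.
have D0 : 0 < D by exact: lt_le_trans D1.
pose e := (2 * D)^-1.
have e0 : 0 < e by rewrite invr_gt0 mulr_gt0.
have e1 : e <= 1 by rewrite invf_le1 ?mulr_gt0//; lra.
have eD : e * D = 2^-1 by rewrite /e invfM -mulrA mulVf ?mulr1// gt_eqF.
have ec : e * c + e ^+ 2 * a ^+ 2 * c < 1.
  have e2 : e ^+ 2 <= e by rewrite expr2 ler_piMl// ltW.
  have ac : 0 <= a ^+ 2 * c by rewrite mulr_ge0// ltW.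
  have h := ler_wpM2r ac e2.
  have h2 : e * c + e * (a ^+ 2 * c) = 2^-1 - e by rewrite -eD /D; ring.
  by lra.
have t1 : (e * a) ^+ 2 * c < 1.
  by rewrite exprMn; have : 0 <= e * c by [rewrite mulr_ge0// ltW|]; lra.
(* The bound is used at [u = e * a]. As [(1 - t) * expR t <= 1], it gives
   [(1 + e * a ^+ 2) * (1 - t) <= 1], whereas [e] was chosen to make the left side exceed 1. *)
have := H (e * a); set t := _ ^+ 2 * c in t1 *.
have : 1 - t <= expR (- t) by exact: expR_ge1Dx.
rewrite expRN => h1 h2.
have : (1 + e * a * a) * (1 - t) <= 1.
  apply: (@le_trans _ _ (expR t * (1 - t))).
    by rewrite ler_wpM2r// subr_ge0 ltW.
  by rewrite mulrC -ler_pdivlMr ?expR_gt0// mul1r.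
have -> : (1 + e * a * a) * (1 - t) =
    1 + e * a ^+ 2 * (1 - (e * c + e ^+ 2 * a ^+ 2 * c)) by rewrite /t; ring.
rewrite gerDl leNgt => /negP; apply.
by apply: mulr_gt0; [exact: mulr_gt0|rewrite subr_gt0].
Qed.

(** The parameters of the law must be identified with the expectation and the covariance. For
    [W = Z - m], the even moment of order 2 gives square integrability and the variance [s ^+ 2],
    and [centered_of_exp_bound] gives mean zero. *)
Lemma gaussian_variable_mgf : gaussian_variable P Z ->
  Z \in Lfun P 2%:E /\ forall u,
  (\int[P]_w (expR (u * Z w))%:E =
   (expR (u * fine 'E_P[Z] + u ^+ 2 * fine (covariance P Z Z) / 2))%:E)%E.
Proof.
move=> [m [s ZE]].
have mgf u : (\int[P]_w (expR (u * Z w))%:E =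
    (expR (u * m + u ^+ 2 * s ^+ 2 / 2))%:E)%E.
  have mexp : measurable_fun setT (fun y : R => (expR (u * y))%:E).
    by apply/measurable_EFinP; apply: measurableT_comp => //; exact: measurable_funM.
  have [s0|s0] := eqVneq s 0.
    rewrite (@ge0_integral_law (@dirac _ (measurableTypeR R) m R) (fun y => (expR (u * y))%:E))//.
    - by rewrite integral_dirac// diracT mul1e s0 expr0n/= mulr0 mul0r addr0.
    - by move=> B mB; rewrite ZE// /gaussian_law s0 eqxx.
  rewrite (@ge0_integral_law (normal_prob m s) (fun y => (expR (u * y))%:E))//.
  - by rewrite normal_mgf.
  - by move=> B mB; rewrite ZE// /gaussian_law (negbTE s0).
pose W w := Z w - m.
have mW : measurable_fun setT W by exact: measurable_funB.
have mgfW u : (\int[P]_w (1 * expR (u * W w))%:E =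
    (1 * expR (u ^+ 2 * s ^+ 2 / 2))%:E)%E.
  transitivity (\int[P]_w ((expR (- (u * m)))%:E * (expR (u * Z w))%:E))%E.
    apply: eq_integral => w _; rewrite mul1r -EFinM -expRD.
    by congr (expR _)%:E; rewrite /W; ring.
  rewrite ge0_integralZl_EFin ?expR_ge0//; last first.
    apply/measurable_EFinP; apply: measurableT_comp => //.
    exact: measurable_funM.
  by rewrite mgf -EFinM -expRD mul1r; congr (expR _)%:E; ring.
have W2 : (\int[P]_w (W w ^+ 2)%:E = (s ^+ 2)%:E)%E.
  have := @even_moments _ _ _ P (fun=> 1) W 1 (s ^+ 2) _ mW _ _ _ mgfW 1.
  have E2 (r : R) : 1 * cosh_coeff r 1 = 2^-1 * r ^+ 2.
    by rewrite /cosh_coeff mul1r mulrC.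
  under eq_integral do rewrite E2 EFinM.
  rewrite ge0_integralZl_EFin ?invr_ge0//; last 2 first.
  - by move=> w _; rewrite lee_fin sqr_ge0.
  - by apply/measurable_EFinP; exact: measurable_funX.
  move=> /(_ _ _ _ _)/(congr1 (fun z => 2%:E * z)%E).
  rewrite muleA -!EFinM divff// mul1e => -> //; last exact: sqr_ge0.
  by rewrite factS fact0 expr1 mul1r divr1; congr (_%:E); field.
have WL2 : W \in Lfun P 2%:E by apply: Lfun2_sqr => //; rewrite W2 ltry.
have Pfin : P setT \is a fin_num := fin_num_measure P _ measurableT.
have WL1 := Lfun_subset12 Pfin WL2.
have EW : 'E_P[W]%E = 0%E.
  rewrite -(fineK (expectation_fin_num WL1)); congr (_%:E).
  apply: (@centered_of_exp_bound _ (s ^+ 2 / 2)) => [|u].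
    by rewrite divr_ge0// sqr_ge0.
  rewrite -lee_fin EFinD EFinM fineK ?expectation_fin_num//.
  have := mgfW u; rewrite mul1r mulrA => <-.
  rewrite -expectationZl// -(expectation_cst P) -expectationD ?Lfun_cst ?Lfun_scale//.
  rewrite unlock; apply: le_integral => //.
  - apply/Lfun1_integrable; rewrite rpredD ?Lfun_cst ?Lfun_scale//.
  - apply/integrableP; split.
      apply/measurable_EFinP; under eq_fun do rewrite mul1r.
      apply: measurableT_comp => //; exact: measurable_funM.
    rewrite (eq_integral (fun w => (1 * expR (u * W w))%:E)) ?mgfW ?ltry// => w _.
    by rewrite /= !mul1r ger0_norm ?expR_ge0.
  - by move=> w _; rewrite lee_fin mul1r /= mulrC; exact: expR_ge1Dx.
have ZW : Z = W \+ cst m by apply/funext => w; rewrite /W /= subrK.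
have EZ : 'E_P[Z]%E = m%:E.
  by rewrite ZW expectationD ?Lfun_cst// EW expectation_cst add0e.
have VZ : covariance P Z Z = (s ^+ 2)%:E.
  by rewrite unlock EZ -W2 unlock.
split; first by rewrite ZW rpredD ?lee1n//= Lfun_cst.
by move=> u; rewrite mgf EZ VZ.
Qed.

End gaussian_moments.

(** * Quadratic weights of a Gaussian sequence *)

Section weighted_gaussian.
Context {d : measure_display} {T : measurableType d} {R : realType}.
Variable P : probability T R.
Variables (X : nat -> T -> R) (n : nat).
Variables (m S B : nat -> R) (K gamma : nat -> nat -> R).

(* [kmean l] and [kcov l] are the mean and the covariance of
   [(X_t)_{l < t <= n}] under [P] weighted by [exp (kexponent l)], whose total
   mass is [kweight l]; the equation for [gamma] says that [gamma t s] is
   [kcov s.-1 t s]. *)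
Fixpoint kmean (l t : nat) : R :=
  if l is k.+1 then
    kmean k t + gamma t l * ((B l - S l * kmean k l) / (1 + S l * gamma l l))
  else m t.

Definition kcov (l t s : nat) : R :=
  K t s - \sum_(1 <= j < l.+1)
            gamma t j * gamma s j * (S j / (1 + S j * gamma j j)).

(** The expectation of [expR (B l * x - S l / 2 * x ^+ 2)] when [x] is Gaussian with mean [z] and
    variance [gamma l l]. *)
Definition kfactor (l : nat) (z : R) : R :=
  (Num.sqrt (1 + S l * gamma l l))^-1 *
  expR ((B l * z + B l ^+ 2 * gamma l l / 2 - S l / 2 * z ^+ 2) /
        (1 + S l * gamma l l)).

Definition kweight (l : nat) : R :=
  \prod_(1 <= j < l.+1) kfactor j (kmean j.-1 j).

Definition kexponent (l : nat) (w : T) : R :=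
  \sum_(1 <= s < l.+1) (B s * X s w - S s / 2 * X s w ^+ 2).

Hypothesis mX : forall t, measurable_fun setT (X t).
Hypothesis Ksym : forall t s, (1 <= t <= n)%N -> (1 <= s <= n)%N ->
  K t s = K s t.
Hypothesis mgfX : forall c : nat -> R,
  (\int[P]_w (expR (\sum_(1 <= t < n.+1) c t * X t w))%:E =
   (expR (\sum_(1 <= t < n.+1) c t * m t +
     (\sum_(1 <= t < n.+1) \sum_(1 <= s < n.+1) c t * c s * K t s) / 2))%:E)%E.
Hypothesis ric : forall t s, (1 <= s <= t)%N -> (t <= n)%N ->
  gamma t s = K t s - \sum_(1 <= l < s)
                gamma t l * gamma s l * (S l / (1 + S l * gamma l l)).
Hypothesis gpos : forall l, (1 <= l <= n)%N ->
  0 <= gamma l l /\ 0 < 1 + S l * gamma l l.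

Let kcov_sym l t s : (1 <= t <= n)%N -> (1 <= s <= n)%N ->
  kcov l t s = kcov l s t.
Proof.
move=> tn sn; rewrite /kcov Ksym//; congr (_ - _).
by apply: eq_bigr => j _; rewrite (mulrC (gamma t j)).
Qed.

Let kcov_gamma l t : (l < t <= n)%N -> kcov l t l.+1 = gamma t l.+1.
Proof. by move=> /andP[lt tn]; rewrite [RHS]ric. Qed.

Let kweight_ge0 l : 0 <= kweight l.
Proof.
by apply: prodr_ge0 => j _; rewrite mulr_ge0 ?expR_ge0// invr_ge0 sqrtr_ge0.
Qed.

Let mexponent l : measurable_fun setT (kexponent l).
Proof.
apply: measurable_sum => s; apply: measurable_funB; apply: measurable_funM => //.
exact: measurable_funX.
Qed.

Let mlin (c : nat -> R) l :
  measurable_fun setT (fun w => \sum_(l <= t < n.+1) c t * X t w).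
Proof. by apply: measurable_sum => s; exact: measurable_funM. Qed.

(** Induction on [l]. With an extra coefficient [u] at time [k = l.+1], the induction hypothesis
    gives the generating function of [X k] under the weight [g]; [gaussian_mgf_quadratic] then
    absorbs the quadratic weight at [k]. The new exponent is again quadratic in [c], and its
    coefficients are the updated mean and covariance. *)
Lemma weighted_gaussian_mgf l (c : nat -> R) : (l <= n)%N ->
  (\int[P]_w (expR (kexponent l w + \sum_(l.+1 <= t < n.+1) c t * X t w))%:E =
   (kweight l * expR (\sum_(l.+1 <= t < n.+1) c t * kmean l t +
     (\sum_(l.+1 <= t < n.+1) \sum_(l.+1 <= s < n.+1)
        c t * c s * kcov l t s) / 2))%:E)%E.
Proof.
elim: l c => [|l IH] c ln.
  rewrite /kweight big_geq// mul1r.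
  rewrite /kexponent; under eq_integral do rewrite big_geq// add0r.
  rewrite mgfX; congr (expR (_ + _ / 2))%:E.
  apply: eq_bigr => t _; apply: eq_bigr => s _.
  by rewrite /kcov big_geq// subr0.
set k := l.+1.
have [v0 Sv] := gpos k ln.
(* For the linear form with coefficients [c] under the weight accumulated up to [l]: [kap] is its
   covariance with [X k], [L] its mean and [D] its variance. *)
pose kap := \sum_(k.+1 <= t < n.+1) c t * gamma t k.
pose L := \sum_(k.+1 <= t < n.+1) c t * kmean l t.
pose D := \sum_(k.+1 <= t < n.+1) \sum_(k.+1 <= s < n.+1)
  c t * c s * kcov l t s.
pose g w := expR (kexponent l w + \sum_(k.+1 <= t < n.+1) c t * X t w).
pose N := kweight l * expR (L + D / 2).
have mgf u : (\int[P]_w (g w * expR (u * X k w))%:E =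
    (N * expR (u * (kmean l k + kap) + u ^+ 2 * gamma k k / 2))%:E)%E.
  pose c' t := if t == k then u else c t.
  have c'c t : (k.+1 <= t < n.+1)%N -> c' t = c t.
    by move=> /andP[kt _]; rewrite /c' gtn_eqF.
  have c'k : c' k = u by rewrite /c' eqxx.
  have split1 F : \sum_(k <= t < n.+1) F t =
      F k + \sum_(k.+1 <= t < n.+1) F t :> R by rewrite big_ltn.
  transitivity (\int[P]_w
      (expR (kexponent l w + \sum_(l.+1 <= t < n.+1) c' t * X t w))%:E)%E.
    apply: eq_integral => w _; rewrite -expRD split1 c'k.
    rewrite [in RHS](eq_big_nat _ _ (F2 := fun t => c t * X t w)); last first.
      by move=> t tn; rewrite c'c.
    by congr (expR _)%:E; ring.
  rewrite IH ?(ltnW ln)// /N -mulrA -expRD; congr (_ * expR _)%:E.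
  have kn : (1 <= k <= n)%N by [].
  have rng t : (k.+1 <= t < n.+1)%N -> (l < t <= n)%N.
    by rewrite ltnS => /andP[/ltnW -> ->].
  have rng1 t : (k.+1 <= t < n.+1)%N -> (1 <= t <= n)%N.
    by move=> /rng/andP[lt ->]; rewrite (leq_ltn_trans _ lt).
  have -> : \sum_(k <= t < n.+1) c' t * kmean l t = u * kmean l k + L.
    by rewrite split1 c'k; congr (_ + _); apply: eq_big_nat => t tn; rewrite c'c.
  have -> : \sum_(k <= t < n.+1) \sum_(k <= s < n.+1) c' t * c' s * kcov l t s =
      u ^+ 2 * gamma k k + 2 * u * kap + D.
    have kk : kcov l k k = gamma k k by rewrite kcov_gamma// ltnSn.
    have col t : (k.+1 <= t < n.+1)%N -> kcov l t k = gamma t k.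
      by move=> /rng tn; rewrite kcov_gamma.
    rewrite split1 split1 c'k kk.
    rewrite (eq_big_nat _ _ (F2 := fun s => u * (c s * gamma s k))); last first.
      by move=> s sn; rewrite c'c// (kcov_sym l k s kn (rng1 s sn)) col// mulrA.
    rewrite -mulr_sumr -/kap.
    rewrite (eq_big_nat _ _ (F2 := fun t => u * (c t * gamma t k) +
        \sum_(k.+1 <= s < n.+1) c t * c s * kcov l t s)); last first.
      move=> t tn; rewrite split1 c'k c'c// col//; congr (_ + _); first by ring.
      by apply: eq_big_nat => s sn; rewrite c'c.
    by rewrite big_split/= -mulr_sumr -/kap -/D; ring.
  by field.
have mg : measurable_fun setT g.
  apply: measurableT_comp => //; apply: measurable_funD; first exact: mexponent.
  exact: mlin.
have N0 : 0 <= N by rewrite mulr_ge0 ?kweight_ge0 ?expR_ge0.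
have g0 w : 0 <= g w by exact: expR_ge0.
have H := gaussian_mgf_quadratic P _ _ N _ _ (S k) (B k) mg (mX k) g0 N0 v0 mgf Sv.
transitivity (\int[P]_w (g w * expR (B k * X k w - S k / 2 * X k w ^+ 2))%:E)%E.
  apply: eq_integral => w _; rewrite -expRD /kexponent big_nat_recr//=.
  by congr (expR _)%:E; ring.
rewrite H /kweight big_nat_recr//= -/(kweight l) /kfactor -/k /N.
have -> : \sum_(k.+1 <= t < n.+1) c t * (kmean l t + gamma t k *
    ((B k - S k * kmean l k) / (1 + S k * gamma k k))) =
    L + kap * ((B k - S k * kmean l k) / (1 + S k * gamma k k)).
  rewrite /L /kap mulr_suml -big_split/=; apply: eq_bigr => t _.
  by rewrite mulrDr mulrA.
have -> : \sum_(k.+1 <= t < n.+1) \sum_(k.+1 <= s < n.+1)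
    c t * c s * kcov k t s = D - kap ^+ 2 * (S k / (1 + S k * gamma k k)).
  rewrite /D expr2 {1}/kap !mulr_suml -sumrB; apply: eq_bigr => t _.
  rewrite -mulrA /kap mulr_suml mulr_sumr -sumrB; apply: eq_bigr => s _.
  by rewrite /kcov big_nat_recr//= -/k; ring.
set z := kmean l k; set q := Num.sqrt _.
transitivity (kweight l / q * (expR (L + D / 2) * expR ((B k * (z + kap) +
    B k ^+ 2 * gamma k k / 2 - S k / 2 * (z + kap) ^+ 2) /
    (1 + S k * gamma k k)))%R)%:E; first by congr (_%:E); ring.
rewrite -expRD; set E1 := expR (_ + _ / _).
transitivity (kweight l / q * (expR ((B k * z + B k ^+ 2 * gamma k k / 2 -
    S k / 2 * z ^+ 2) / (1 + S k * gamma k k)) *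
  expR (L + kap * ((B k - S k * z) / (1 + S k * gamma k k)) +
    (D - kap ^+ 2 * (S k / (1 + S k * gamma k k))) / 2))%R)%:E; last first.
  by congr (_%:E); ring.
rewrite -expRD; congr (_ * expR _)%:E; field.
by rewrite gt_eqF.
Qed.

Lemma weighted_gaussian_integral :
  (\int[P]_w (expR (kexponent n w))%:E = (kweight n)%:E)%E.
Proof.
have := weighted_gaussian_mgf n (fun=> 0) (leqnn n).
under eq_integral do rewrite big_geq// addr0.
by rewrite !big_geq// mul0r addr0 expR0 mulr1.
Qed.

End weighted_gaussian.

(** * The reference measure *)

Local Notation gsig I Z := (g_sigma_algebraType (sigma_generator I Z)).
Local Notation upto k := [set u | (1 <= u <= k)%N].
Local Notation times := [set t | (1 <= t)%N].

Lemma bigcap_1S (T : Type) (F : nat -> set T) n :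
  \bigcap_(i in [set u | (1 <= u <= n.+1)%N]) F i =
  \bigcap_(i in [set u | (1 <= u <= n)%N]) F i `&` F n.+1.
Proof.
apply/seteqP; split => [w Fw|w [Fw Fn] i /= /andP[i1]].
  split; last by apply: Fw; rewrite /= leqnn.
  by move=> i /= /andP[i1 ni]; apply: Fw; rewrite /= i1 (leqW ni).
by rewrite leq_eqVlt => /orP[/eqP -> //|ni]; apply: Fw; rewrite /= i1.
Qed.

Lemma bigcap_10 (T : Type) (F : nat -> set T) :
  \bigcap_(i in [set u | (1 <= u <= 0)%N]) F i = setT.
Proof.
by apply/seteqP; split => // w _ i /= /andP[i1 i0]; move: (leq_trans i1 i0).
Qed.

Lemma measurable_fun_fst (d1 d2 d3 : measure_display) (T1 : measurableType d1)
  (T2 : measurableType d2) (U : measurableType d3) (f : T1 -> U) :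
  measurable_fun setT f -> measurable_fun [set: T1 * T2] (fun z => f z.1).
Proof. by move=> mf; exact: (measurableT_comp mf measurable_fst). Qed.

Lemma measurable_fun_snd (d1 d2 d3 : measure_display) (T1 : measurableType d1)
  (T2 : measurableType d2) (U : measurableType d3) (f : T2 -> U) :
  measurable_fun setT f -> measurable_fun [set: T1 * T2] (fun z => f z.2).
Proof. by move=> mf; exact: (measurableT_comp mf measurable_snd). Qed.

(** * Densities, generated sigma-algebras and cylinders *)

Section cylinders.
Context {d : measure_display} {T : measurableType d} {R : realType}.

Lemma exists_probability_density (mu : probability T R) (f : T -> R) :
  measurable_fun setT f -> (forall x, 0 <= f x) ->
  (\int[mu]_x (f x)%:E = 1)%E ->
  exists nu : probability T R,
    forall A, measurable A -> nu A = (\int[mu]_(x in A) (f x)%:E)%E.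
Proof.
move=> mf f0 f1.
pose m A := (\int[mu]_(x in A) (f x)%:E)%E.
have m0 : m set0 = 0%E by rewrite /m integral_set0.
have mge0 A : (0 <= m A)%E.
  by apply: integral_ge0 => x _; rewrite lee_fin.
have msa : semi_sigma_additive m.
  move=> F mF tF mUF; rewrite /m ge0_integral_bigcup//.
  - by apply: is_cvg_ereal_nneg_natsum_cond => k _ _; exact: mge0.
  - exact/measurable_EFinP/measurable_funTS.
  - by move=> x _; rewrite lee_fin.
pose nu : {measure set T -> \bar R} :=
  HB.pack m (isMeasure.Build _ _ _ m m0 mge0 msa).
have nuT : nu setT = 1%E by [].
(* [mnormalize] only serves to pack [nu], of total mass 1, as a probability. *)
exists (mnormalize nu mu) => A mA.
by rewrite /= /mnormalize nuT onee_eq0/= invr1 mule1.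
Qed.

Lemma measurable_gsig (I : set nat) (Z : nat -> T -> R) (i : nat) :
  I i -> measurable_fun [set: gsig I Z] (Z i : gsig I Z -> R).
Proof.
move=> Ii _ B mB; rewrite setTI; apply: sub_sigma_algebra.
by exists i => //; exists B => //; rewrite setTI.
Qed.

Lemma gsig_sub (I J : set nat) (Z : nat -> T -> R) (d' : measure_display)
  (U : measurableType d') (f : T -> U) : I `<=` J ->
  measurable_fun [set: gsig I Z] (f : gsig I Z -> U) ->
  measurable_fun [set: gsig J Z] (f : gsig J Z -> U).
Proof.
move=> IJ mf _ B mB; have := mf measurableT B mB.
by apply: sub_sigma_algebra2 => E [i Ii sE]; exists i => //; exact: IJ.
Qed.

Lemma gsig_measurable (I : set nat) (Z : nat -> T -> R) :
  (forall i, measurable_fun setT (Z i)) ->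
  <<s sigma_generator I Z >> `<=` measurable.
Proof.
move=> mZ; apply: smallest_sub; first exact: sigma_algebra_measurable.
by move=> _ [i _ [B mB <-]]; exact: mZ.
Qed.

(** The identity into the coarser measurable space plays the role of a random element; this is how
    [ge0_integral_independent] is applied to independent sigma-algebras. *)
Lemma measurable_id_gsig (I : set nat) (Z : nat -> T -> R) :
  (forall i, measurable_fun setT (Z i)) ->
  measurable_fun setT (id : T -> gsig I Z).
Proof. by move=> mZ _ B mB; rewrite setTI; exact: (gsig_measurable I Z mZ B mB). Qed.

Variable P : probability T R.

(** As functions of [G], both sides are measures, the restriction of [P] to [F] and a multiple of
    [P], and they agree on cylinders. *)
Lemma independent_of_cylinders (I : set nat) (Z : nat -> T -> R) (F : set T) (c : R) :
  (forall i, measurable_fun setT (Z i)) -> measurable F -> 0 <= c ->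
  (forall B : nat -> set R, (forall i, measurable (B i)) ->
    P (\bigcap_(i in I) (Z i @^-1` B i) `&` F) =
    (P (\bigcap_(i in I) (Z i @^-1` B i)) * c%:E)%E) ->
  forall G, <<s sigma_generator I Z >> G -> P (G `&` F) = (P G * c%:E)%E.
Proof.
move=> mZ mF c0 H G sG; rewrite muleC.
apply: (@cylinder_measure_unique _ _ _ (mrestr P mF) (mscale (NngNum c0) P) I Z) => //.
- by rewrite /= /mrestr setTI; apply: le_lt_trans (probability_le1 _ mF) _; rewrite ltry.
- by move=> B mB; rewrite /= /mrestr /mscale/= H// muleC.
Qed.

End cylinders.

(** * Independent standard normal noise *)

Section noise.
Context {d : measure_display} {T : measurableType d} {R : realType}.
Variables (P : probability T R) (eps : nat -> T -> R).
Hypothesis meps : forall t, measurable_fun setT (eps t).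
Hypothesis heps : iid_standard_normal P eps.
Local Notation gam := (@normal_prob R 0 1).

Let noise_law t B : (1 <= t)%N -> measurable B -> P (eps t @^-1` B) = gam B.
Proof. by move=> t1 mB; rewrite heps.2. Qed.

Lemma noise_independent n B G : measurable B ->
  <<s sigma_generator [set u | (1 <= u <= n)%N] eps >> G ->
  P (G `&` eps n.+1 @^-1` B) = (P G * P (eps n.+1 @^-1` B))%E.
Proof.
move=> mB sG.
have mF : measurable (eps n.+1 @^-1` B) by rewrite -[_ @^-1` _]setTI; exact: meps.
rewrite -(fineK (fin_num_measure P _ mF)).
apply: (@independent_of_cylinders _ _ _ P [set u | (1 <= u <= n)%N] eps) => //; first exact: fine_ge0.
move=> C mC; rewrite fineK ?fin_num_measure//.
have setE k : [set u | (1 <= u <= k)%N] = [set` iota 1 k].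
  by apply/seteqP; split => u /=; rewrite mem_iota add1n ltnS.
have ind k (D : nat -> set R) : (forall i, measurable (D i)) ->
    P (\bigcap_(i in [set u | (1 <= u <= k)%N]) (eps i @^-1` D i)) =
    (\prod_(i <- iota 1 k) P (eps i @^-1` D i))%E.
  move=> mD; rewrite setE; apply: heps.1 => //; first exact: iota_uniq.
  by move=> i /=; rewrite mem_iota => /andP[].
(* Intersecting a cylinder over the first [n] times with the event at [n.+1] gives a cylinder over
   [n.+1] times, to which the product formula applies. *)
pose D i := if i == n.+1 then B else C i.
have mD i : measurable (D i) by rewrite /D; case: eqP.
have -> : \bigcap_(i in [set u | (1 <= u <= n)%N]) (eps i @^-1` C i) `&`
    eps n.+1 @^-1` B =
    \bigcap_(i in [set u | (1 <= u <= n.+1)%N]) (eps i @^-1` D i).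
  rewrite bigcap_1S {2}/D eqxx; congr (_ `&` _).
  by apply: eq_bigcapr => i /= /andP[_ ni]; rewrite /D ltn_eqF.
rewrite !ind// (_ : iota 1 n.+1 = iota 1 n ++ [:: n.+1]); last first.
  by rewrite -(addn1 n) iotaD (addnC n 1%N).
rewrite big_cat/= big_seq1 {2}/D eqxx.
congr (_ * _)%E; apply: eq_big_seq => i; rewrite mem_iota add1n ltnS.
by move=> /andP[_ ni]; rewrite /D ltn_eqF.
Qed.

(** Induction on [n]: the last noise variable is independent of the sigma-algebra of the previous
    ones and is integrated out first. *)
Lemma noise_prod_integral n (phi : nat -> R -> R) (a : nat -> R) :
  (forall t, measurable_fun setT (phi t)) -> (forall t y, 0 <= phi t y) ->
  (forall t, (\int[gam]_y (phi t y)%:E = (a t)%:E)%E) ->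
  (\int[P]_w (\prod_(1 <= t < n.+1) phi t (eps t w))%:E =
   (\prod_(1 <= t < n.+1) a t)%:E)%E.
Proof.
move=> mphi phi0 phia; elim: n => [|n IH].
  rewrite big_geq//; under eq_integral do rewrite big_geq//.
  by rewrite integral_cst//= probability_setT mule1.
pose I := [set u | (1 <= u <= n)%N].
pose g (z : gsig I eps * measurableTypeR R) :=
  ((\prod_(1 <= t < n.+1) phi t (eps t z.1)) * phi n.+1 z.2)%:E.
have mprod : measurable_fun [set: gsig I eps]
    (fun w : gsig I eps => \prod_(1 <= t < n.+1) phi t (eps t w)).
  apply: measurable_prod => t; rewrite mem_index_iota ltnS => tn.
  by apply: measurableT_comp => //; exact: measurable_gsig.
have mg : measurable_fun setT g.
  apply/measurable_EFinP; apply: measurable_funM.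
    exact: (measurableT_comp mprod).
  have mphi1 : @measurable_fun _ _ (measurableTypeR R) _ setT (phi n.+1).
    exact: mphi.
  exact: (measurableT_comp mphi1 measurable_snd).
have g0 z : (0 <= g z)%E by rewrite lee_fin mulr_ge0// prodr_ge0.
have [H _] := @ge0_integral_independent _ _ _ T (gsig I eps) (measurableTypeR R)
  R P P P id (eps n.+1) (measurable_id_gsig I eps meps) (meps n.+1)
  (fun A B mA mB => noise_independent n B A mB mA) g mg g0.
transitivity (\int[P]_w g (w, eps n.+1 w))%E.
  by apply: eq_integral => w _; rewrite /g/= big_nat_recr.
rewrite H /g/=.
transitivity (\int[P]_w ((\prod_(1 <= t < n.+1) phi t (eps t w))%:E * (a n.+1)%:E))%E.
  apply: eq_integral => w _; under eq_integral do rewrite EFinM.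
  rewrite ge0_integralZl_EFin ?prodr_ge0//; last 2 first.
  - by move=> y _; rewrite lee_fin.
  - by apply/measurable_EFinP; exact: measurableT_comp.
  congr (_ * _)%E; rewrite -phia.
  apply: (@ge0_integral_law _ _ _ P (eps n.+1) (meps n.+1) gam
    (fun y => (phi n.+1 y)%:E)).
  - by move=> B mB; exact: noise_law.
  - exact/measurable_EFinP.
  - by move=> y; rewrite lee_fin.
have an0 : 0 <= a n.+1.
  by rewrite -lee_fin -phia; apply: integral_ge0 => y _; rewrite lee_fin.
rewrite ge0_integralZr//; last 2 first.
- apply/measurable_EFinP; apply: measurable_prod => t _.
  exact: measurableT_comp.
- by move=> w _; rewrite lee_fin prodr_ge0.
by rewrite IH -EFinM [in RHS]big_nat_recr.
Qed.

End noise.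

(** * Change of measure making the observations pure noise *)

Section reference_measure.
Context {d : measure_display} {T : measurableType d} {R : realType}.
Variables (P : probability T R) (X eps : nat -> T -> R) (A : nat -> R) (n : nat).
Hypothesis mX : forall t, measurable_fun setT (X t).
Hypothesis meps : forall t, measurable_fun setT (eps t).
Hypothesis heps : iid_standard_normal P eps.
Hypothesis hXeps : independent_sequences P [set t | (1 <= t)%N] X eps.
Local Notation gam := (@normal_prob R 0 1).
Local Notation Y := (observation A X eps).

(** Substituting [eps = Y - A * X], the inverse of this density is the product of the [expR (A t * X
    t * Y t - (A t * X t) ^+ 2 / 2)], the usual likelihood ratio. *)
Definition likelihood_inv (w : T) : R := \prod_(1 <= t < n.+1)
  expR (- (A t * X t w) * eps t w - (A t * X t w) ^+ 2 / 2).

Lemma measurable_observation t : measurable_fun setT (Y t).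
Proof. by apply: measurable_funD => //; exact: measurable_funM. Qed.

Lemma measurable_likelihood_inv : measurable_fun setT likelihood_inv.
Proof.
apply: measurable_prod => t _; apply: measurableT_comp => //.
apply: measurable_funB; last first.
  by apply: measurable_funM => //; apply: measurable_funX; exact: measurable_funM.
by apply: measurable_funM => //; apply: measurableT_comp => //; exact: measurable_funM.
Qed.

Lemma likelihood_inv_gt0 w : 0 < likelihood_inv w.
Proof. by apply: prodr_gt0 => t _; exact: expR_gt0. Qed.

Lemma indic_bigcap_1 (F : nat -> set T) k w :
  \1_(\bigcap_(i in upto k) F i) w = \prod_(1 <= t < k.+1) \1_(F t) w :> R.
Proof.
elim: k => [|k IH]; first by rewrite bigcap_10 big_geq// indicT.
by rewrite bigcap_1S indicI big_nat_recr//= -IH.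
Qed.

(** By independence [X] can be frozen while the noise is integrated. Then [normal_shift] absorbs
    each translation by [A t * X t] into the weight, and leaves the Gaussian measure of [B t]
    whatever the value of [X]. *)
Lemma likelihood_inv_cylinder (B : nat -> set R) E : (forall t, measurable (B t)) ->
  <<s sigma_generator times X >> E ->
  (\int[P]_(w in \bigcap_(i in upto n) (Y i @^-1` B i) `&` E) (likelihood_inv w)%:E =
   P E * (\prod_(1 <= t < n.+1) fine (gam (B t)))%:E)%E.
Proof.
move=> mB sE.
have mE : measurable E by exact: (gsig_measurable times X mX).
pose phi (w : T) t y := \1_(B t) (A t * X t w + y) *
  expR (- (A t * X t w) * y - (A t * X t w) ^+ 2 / 2).
have phi0 w t y : 0 <= phi w t y by rewrite mulr_ge0 ?expR_ge0.
have mphi w t : measurable_fun setT (phi w t).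
  apply: measurable_funM.
    by apply: measurableT_comp => //; exact: measurable_funD.
  apply: measurableT_comp => //; exact: measurable_funB.
pose g (z : gsig times X * gsig times eps) : \bar R :=
  (\1_E z.1 * \prod_(1 <= t < n.+1) phi z.1 t (eps t z.2))%:E.
have mg : measurable_fun setT g.
  apply/measurable_EFinP; apply: measurable_funM.
    have mE' : measurable_fun [set: gsig times X] (\1_E : _ -> R).
      exact: measurable_indic.
    exact: (measurableT_comp mE').
  apply: measurable_prod => t; rewrite mem_index_iota => /andP[t1 _].
  have mXt : measurable_fun [set: gsig times X * gsig times eps] (fun z => X t z.1).
    exact: (measurable_fun_fst _ _ _ (gsig times X) (gsig times eps) R (X t)
      (measurable_gsig times X t t1)).
  have met : measurable_fun [set: gsig times X * gsig times eps] (fun z => eps t z.2).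
    exact: (measurable_fun_snd _ _ _ (gsig times X) (gsig times eps) R (eps t)
      (measurable_gsig times eps t t1)).
  have mAX := measurable_funM (measurable_cst (A t)) mXt.
  apply: measurable_funM.
    have mBt : measurable_fun [set: R] (\1_(B t) : R -> R) by exact: measurable_indic.
    apply: (measurableT_comp mBt).
    exact: measurable_funD.
  apply: measurableT_comp => //; apply: measurable_funB.
    by apply: measurable_funM => //; exact: measurableT_comp.
  by apply: measurable_funM => //; exact: measurable_funX.
have g0 z : (0 <= g z)%E by rewrite lee_fin mulr_ge0// prodr_ge0.
have [H _] := @ge0_integral_independent _ _ _ T (gsig times X) (gsig times eps)
  R P P P id id (measurable_id_gsig times X mX) (measurable_id_gsig times eps meps)
  (fun E F mE mF => hXeps E F mE mF) g mg g0.
rewrite integral_mkcond.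
transitivity (\int[P]_w g (w, w))%E.
  apply: eq_integral => w _; rewrite patchE /g/= /phi big_split/=.
  rewrite -[\prod_(1 <= _ < _) expR _]/(likelihood_inv w) mulrA mulrC.
  transitivity ((likelihood_inv w * \1_(\bigcap_(i in upto n) (Y i @^-1` B i) `&` E) w)%:E).
    by rewrite indicE; case: ifP; rewrite ?mulr1 ?mulr0.
  by rewrite indicI/= indic_bigcap_1 (mulrC (\1_E w)).
rewrite H /g/=.
transitivity (\int[P]_w ((\1_E w)%:E * (\prod_(1 <= t < n.+1) fine (gam (B t)))%:E))%E.
  apply: eq_integral => w _; under eq_integral do rewrite EFinM.
  rewrite ge0_integralZl_EFin//; last 2 first.
  - by move=> y _; rewrite lee_fin prodr_ge0.
  - apply/measurable_EFinP; apply: measurable_prod => t _.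
    exact: measurableT_comp.
  congr (_ * _)%E; apply: (noise_prod_integral P eps meps heps) => // t.
  rewrite /phi; under eq_integral do rewrite EFinM.
  rewrite (normal_shift (A t * X t w) (fun y => (\1_(B t) y)%:E)).
  - rewrite integral_indic//=; last exact: mB.
    transitivity (gam (B t)); first by congr (gam _); exact: setIT.
    by apply/esym/fineK/fin_num_measure; exact: mB.
  - exact/measurable_EFinP/measurable_indic.
  - by move=> y; rewrite lee_fin.
have p0 : 0 <= \prod_(1 <= t < n.+1) fine (gam (B t)).
  by apply: prodr_ge0 => t _; exact: fine_ge0.
rewrite ge0_integralZr//.
- by rewrite integral_indic// setIT.
- exact/measurable_EFinP/measurable_indic.
Qed.

(** Every property follows from the value of [nu] on a cylinder in [Y] intersected with an event of
    [X], extended from cylinders to the sigma-algebras they generate. *)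
Lemma reference_measure : exists nu : probability T R,
  [/\ forall S, measurable S -> nu S = (\int[P]_(w in S) (likelihood_inv w)%:E)%E,
      forall E F, <<s sigma_generator times X >> E ->
        <<s sigma_generator (upto n) Y >> F -> nu (E `&` F) = (P E * nu F)%E,
      forall k G B, (k < n)%N -> <<s sigma_generator (upto k) Y >> G ->
        measurable B -> nu (G `&` Y k.+1 @^-1` B) = (nu G * gam B)%E &
      forall k B, (k < n)%N -> measurable B -> nu (Y k.+1 @^-1` B) = gam B].
Proof.
have mY := measurable_observation.
have sT : <<s sigma_generator times X >> setT.
  exact: (@measurableT _ (gsig times X)).
have gamT : fine (gam setT) = 1 by rewrite probability_setT.
(* The cylinder with all sides [setT], intersected with [setT], gives the total mass. *)
have D1 : (\int[P]_w (likelihood_inv w)%:E = 1)%E.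
  have := likelihood_inv_cylinder (fun=> setT) setT (fun=> measurableT) sT.
  rewrite setIT bigcapT// probability_setT mul1e => ->.
  by rewrite big1.
have [nu nuE] := exists_probability_density P likelihood_inv
  measurable_likelihood_inv (fun w => ltW (likelihood_inv_gt0 w)) D1.
have mcyl k (B : nat -> set R) : (forall t, measurable (B t)) ->
    measurable (\bigcap_(i in upto k) (Y i @^-1` B i)).
  move=> mB; apply: bigcap_measurableType => i _.
  by rewrite -[_ @^-1` _]setTI; exact: mY.
have cyl (B : nat -> set R) E : (forall t, measurable (B t)) ->
    <<s sigma_generator times X >> E ->
    nu (\bigcap_(i in upto n) (Y i @^-1` B i) `&` E) =
    (P E * (\prod_(1 <= t < n.+1) fine (gam (B t)))%:E)%E.
  move=> mB sE; rewrite nuE ?likelihood_inv_cylinder//.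
  by apply: measurableI; [exact: mcyl|exact: (gsig_measurable times X mX)].
have cylT (B : nat -> set R) k : (k <= n)%N -> (forall t, measurable (B t)) ->
    nu (\bigcap_(i in upto k) (Y i @^-1` B i)) =
    (\prod_(1 <= t < k.+1) fine (gam (B t)))%:E.
  (* A cylinder over the first [k] times is padded with [setT] up to time [n]; the added factors
     equal 1. *)
  move=> kn mB; pose B' t := if (t <= k)%N then B t else setT.
  have mB' t : measurable (B' t) by rewrite /B'; case: ifP.
  have -> : \bigcap_(i in upto k) (Y i @^-1` B i) =
      \bigcap_(i in upto n) (Y i @^-1` B' i) `&` setT.
    rewrite setIT; apply/seteqP; split => w Bw i /= /andP[i1 ik].
      rewrite /B'; case: ifP => // ik'; apply: Bw; rewrite /= i1.
      by rewrite ik'.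
    by have := Bw i; rewrite /B' /= ik i1 (leq_trans ik kn); exact.
  rewrite cyl// probability_setT mul1e; congr (_%:E).
  rewrite (@big_cat_nat _ _ _ k.+1)//=.
  have -> : \prod_(k.+1 <= t < n.+1) fine (gam (B' t)) = 1.
    by rewrite big_nat big1// => t /andP[kt _]; rewrite /B' leqNgt kt.
  rewrite mulr1; apply: eq_big_nat => t /andP[_ tk].
  by rewrite /B' -ltnS tk.
exists nu; split => //.
- move=> E F sE sF; rewrite setIC muleC.
  have mE : measurable E by exact: (gsig_measurable times X mX).
  rewrite -(fineK (fin_num_measure P _ mE)).
  apply: (@independent_of_cylinders _ _ _ nu (upto n) Y) => //.
    exact: fine_ge0.
  by move=> B mB; rewrite cyl// cylT// fineK ?fin_num_measure// muleC.
- move=> k G B kn sG mB.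
  have mF : measurable (Y k.+1 @^-1` B) by rewrite -[_ @^-1` _]setTI; exact: mY.
  rewrite -(fineK (fin_num_measure gam _ mB)).
  apply: (@independent_of_cylinders _ _ _ nu (upto k) Y) => //.
    exact: fine_ge0.
  move=> C mC; pose D i := if i == k.+1 then B else C i.
  have mD i : measurable (D i) by rewrite /D; case: eqP.
  have -> : \bigcap_(i in upto k) (Y i @^-1` C i) `&` Y k.+1 @^-1` B =
      \bigcap_(i in upto k.+1) (Y i @^-1` D i).
    rewrite bigcap_1S {2}/D eqxx; congr (_ `&` _).
    by apply: eq_bigcapr => i /= /andP[_ ni]; rewrite /D ltn_eqF.
  rewrite !cylT ?(ltnW kn)// big_nat_recr//= {2}/D eqxx EFinM.
  congr (_%:E * _)%E; apply: eq_big_nat => i /andP[_ ik].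
  by rewrite /D ltn_eqF.
- move=> k B kn mB; pose D i := if i == k.+1 then B else setT.
  have mD i : measurable (D i) by rewrite /D; case: eqP.
  have -> : Y k.+1 @^-1` B = \bigcap_(i in upto k.+1) (Y i @^-1` D i).
    rewrite bigcap_1S {2}/D eqxx bigcapT ?setTI// => i /= /andP[_ ik].
    by rewrite /D ltn_eqF.
  rewrite cylT// big_nat_recr//= {2}/D eqxx.
  have -> : \prod_(1 <= t < k.+1) fine (gam (D t)) = 1.
    by rewrite big_nat big1// => t /andP[_ ik]; rewrite /D ltn_eqF.
  by rewrite mul1r fineK// fin_num_measure.
Qed.

End reference_measure.

(** * The exponential cost *)

Section leg_step.
Context {R : realType}.
Variables (a q v : R).
Hypotheses (v0 : 0 <= v) (Sv : 0 < 1 + (a ^+ 2 - q) * v).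
Local Notation S := (a ^+ 2 - q).
Local Notation gam := (@normal_prob R 0 1).

(** The factor [kfactor] for the linear coefficient [a * y - q * h], times the part of the cost in
    [h ^+ 2] that does not involve the signal. Here [a], [q], [v] stand for [A t], [mu * Q t],
    [gamma t t]. *)
Definition leg_step (z h y : R) : R :=
  (Num.sqrt (1 + S * v))^-1 *
  expR (((a * y - q * h) * z + (a * y - q * h) ^+ 2 * v / 2 - S / 2 * z ^+ 2) /
        (1 + S * v)) * expR (q / 2 * h ^+ 2).

(** Equal to [z + v * a * (y - a * z) / (1 + a ^+ 2 * v)], the Kalman correction of the predictor
    [z] with error variance [v]. *)
Definition leg_opt (z y : R) : R := (z + v * a * y) / (1 + a ^+ 2 * v).

(** Up to a constant factor, the density of N(a z, 1 + a^2 v) at [y] relative to N(0, 1), so that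
    its standard normal integral in [y] does not depend on [z]. *)
Definition leg_step_opt (z y : R) : R :=
  (Num.sqrt (1 + S * v))^-1 *
  expR (y ^+ 2 / 2 - (y - a * z) ^+ 2 / 2 / (1 + a ^+ 2 * v)).

Let av : 0 < 1 + a ^+ 2 * v.
Proof. by rewrite ltr_wpDr// mulr_ge0// sqr_ge0. Qed.

Let fac : 0 <= (1 + a ^+ 2 * v) / 2 / (1 + S * v).
Proof. by apply: divr_ge0; [apply: divr_ge0|]; rewrite // ltW. Qed.

(** Completing the square in [h]. The square carries the factor [q] times a nonnegative constant, so
    the sign of [q] decides whether [leg_opt] minimises or maximises the factor. *)
Lemma leg_stepE z h y : leg_step z h y = leg_step_opt z y *
  expR (q * ((1 + a ^+ 2 * v) / 2 / (1 + S * v) * (h - leg_opt z y) ^+ 2)).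
Proof.
rewrite /leg_step /leg_step_opt -!mulrA -!expRD; congr (_ * expR _).
rewrite /leg_opt; field.
by rewrite !gt_eqF.
Qed.

Lemma leg_step_opt_ge0 z y : 0 <= leg_step_opt z y.
Proof. by rewrite mulr_ge0 ?expR_ge0// invr_ge0 sqrtr_ge0. Qed.

Lemma leg_step_ge0 z h y : 0 <= leg_step z h y.
Proof. by rewrite leg_stepE mulr_ge0 ?expR_ge0 ?leg_step_opt_ge0. Qed.

Lemma leg_step_opt_le z h y : 0 <= q -> leg_step_opt z y <= leg_step z h y.
Proof.
move=> q0; rewrite leg_stepE ler_peMr ?leg_step_opt_ge0// -[leLHS]expR0 ler_expR.
by apply: mulr_ge0 => //; exact: mulr_ge0 fac (sqr_ge0 _).
Qed.

Lemma leg_step_opt_ge z h y : q <= 0 -> leg_step z h y <= leg_step_opt z y.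
Proof.
move=> q0; rewrite leg_stepE ler_piMr ?leg_step_opt_ge0// -[leRHS]expR0 ler_expR.
by apply: mulr_le0_ge0 => //; exact: mulr_ge0 fac (sqr_ge0 _).
Qed.

Lemma leg_step_opt_eq z y : leg_step z (leg_opt z y) y = leg_step_opt z y.
Proof. by rewrite leg_stepE subrr expr0n/= !mulr0 expR0 mulr1. Qed.

Lemma measurable_leg_step_opt (d : measure_display) (T : measurableType d)
  (z y : T -> R) : measurable_fun setT z -> measurable_fun setT y ->
  measurable_fun setT (fun w => leg_step_opt (z w) (y w)).
Proof.
move=> mz my; apply: measurable_funM => //; apply: measurableT_comp => //.
apply: measurable_funB; first by apply: measurable_funM => //; exact: measurable_funX.
do 2 apply: measurable_funM => //; apply: measurable_funX.
by apply: measurable_funB => //; exact: measurable_funM.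
Qed.

Lemma measurable_leg_opt (d : measure_display) (T : measurableType d)
  (z y : T -> R) : measurable_fun setT z -> measurable_fun setT y ->
  measurable_fun setT (fun w => leg_opt (z w) (y w)).
Proof.
move=> mz my; apply: measurable_funM => //.
by apply: measurable_funD => //; exact: measurable_funM.
Qed.

Lemma measurable_leg_step (d : measure_display) (T : measurableType d)
  (z h y : T -> R) : measurable_fun setT z -> measurable_fun setT h ->
  measurable_fun setT y ->
  measurable_fun setT (fun w => leg_step (z w) (h w) (y w)).
Proof.
move=> mz mh my; under eq_fun do rewrite leg_stepE.
apply: measurable_funM; first exact: measurable_leg_step_opt.
apply: measurableT_comp => //; do 2 apply: measurable_funM => //.
apply: measurable_funX; apply: measurable_funB => //.
exact: measurable_leg_opt.
Qed.

Lemma leg_step_opt_integral z : (\int[gam]_y (leg_step_opt z y)%:E =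
  (Num.sqrt (1 + a ^+ 2 * v) / Num.sqrt (1 + S * v))%:E)%E.
Proof.
have avn := lt0r_neq0 av.
(* Chosen so that, up to the constant [c], the integrand takes the form handled by
   [normal_exp_quadratic], with [1 + p] the inverse of [1 + a ^+ 2 * v]. *)
pose p := (1 + a ^+ 2 * v)^-1 - 1; pose b := a * z / (1 + a ^+ 2 * v).
have p1 : 1 + p = (1 + a ^+ 2 * v)^-1 by rewrite /p addrC subrK.
have p0 : 0 < 1 + p by rewrite p1 invr_gt0.
pose c := (Num.sqrt (1 + S * v))^-1 * expR (- (a ^+ 2 * z ^+ 2 / 2 / (1 + a ^+ 2 * v))).
have c0 : 0 <= c by rewrite mulr_ge0 ?expR_ge0// invr_ge0 sqrtr_ge0.
transitivity (\int[gam]_y (c%:E * (expR (b * y - p / 2 * y ^+ 2))%:E))%E.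
  apply: eq_integral => y _; rewrite -EFinM /c /leg_step_opt -(mulrA (Num.sqrt _)^-1) -expRD.
  by congr (_ * expR _)%:E; rewrite /p /b; field.
rewrite ge0_integralZl_EFin//; last first.
  apply: measurable_EFin_measurableTypeR; apply: measurableT_comp => //.
  by apply: measurable_funB; apply: measurable_funM => //; exact: measurable_funX.
rewrite normal_exp_quadratic// p1.
rewrite (sqrtrV (ltW av)) !invrK -EFinM /c; congr (_%:E).
have ee : expR (- (a ^+ 2 * z ^+ 2 / 2 / (1 + a ^+ 2 * v))) *
    expR (b ^+ 2 / 2 * (1 + a ^+ 2 * v)) = 1.
  by rewrite -expRD -[RHS]expR0; congr expR; rewrite /b; field.
transitivity (Num.sqrt (1 + a ^+ 2 * v) / Num.sqrt (1 + S * v) *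
    (expR (- (a ^+ 2 * z ^+ 2 / 2 / (1 + a ^+ 2 * v))) *
     expR (b ^+ 2 / 2 * (1 + a ^+ 2 * v)))); first by ring.
by rewrite ee mulr1.
Qed.

End leg_step.

(** * Joint moment generating function of a Gaussian sequence *)

Section gaussian_sequences.
Context {d : measure_display} {T : measurableType d} {R : realType}.
Variables (P : probability T R) (X : nat -> T -> R).
Variables (m : nat -> R) (K : nat -> nat -> R).
Hypothesis mX : forall t, measurable_fun setT (X t).
Hypothesis hX : gaussian_sequence P X.
Hypothesis hmK : has_mean_cov P X m K.

Lemma gaussian_sequence_Lfun2 t : (1 <= t)%N -> X t \in Lfun P 2%:E.
Proof.
move=> t1; apply: (gaussian_variable_mgf P (X t) (mX t) _).1.
have := hX t (fun s => (s == t)%:R).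
rewrite (_ : (fun w => _) = X t)//; apply/funext => w.
rewrite big_nat_recr//= eqxx mul1r big_nat big1 ?add0r// => s /andP[_ st].
by rewrite ltn_eqF// mul0r.
Qed.

Lemma gaussian_sequence_cov_sym t s : (1 <= t)%N -> (1 <= s)%N -> K t s = K s t.
Proof.
by move=> t1 s1; apply: EFin_inj; rewrite -!hmK.2// covarianceC.
Qed.

Lemma gaussian_sequence_mgf n (c : nat -> R) :
  (\int[P]_w (expR (\sum_(1 <= t < n.+1) c t * X t w))%:E =
   (expR (\sum_(1 <= t < n.+1) c t * m t +
     (\sum_(1 <= t < n.+1) \sum_(1 <= s < n.+1) c t * c s * K t s) / 2))%:E)%E.
Proof.
pose Z w := \sum_(1 <= t < n.+1) c t * X t w.
have X2 := gaussian_sequence_Lfun2.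
have mZ : measurable_fun setT Z.
  by apply: measurable_sum => t; exact: measurable_funM.
have EZ : 'E_P[Z]%E = (\sum_(1 <= t < n.+1) c t * m t)%:E.
  rewrite expectation_lincomb// -sumEFin; apply: eq_big_nat => t /andP[t1 _].
  by rewrite hmK.1.
have VZ : covariance P Z Z =
    (\sum_(1 <= t < n.+1) \sum_(1 <= s < n.+1) c t * c s * K t s)%:E.
  rewrite covariance_lincombl//; last exact: Lfun2_sum.
  rewrite -sumEFin; apply: eq_big_nat => t /andP[t1 _].
  rewrite covarianceC covariance_lincombl//; last exact: X2.
  under [in RHS]eq_bigr do rewrite -mulrA.
  rewrite -mulr_sumr EFinM; congr (_ * _)%E; rewrite -sumEFin.
  apply: eq_big_nat => s /andP[s1 _].
  by rewrite hmK.2// gaussian_sequence_cov_sym// EFinM.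
have [_ /(_ 1)] := gaussian_variable_mgf P Z mZ (hX n c).
rewrite EZ VZ/= expr1n !mul1r => <-.
by apply: eq_integral => w _; rewrite mul1r.
Qed.

End gaussian_sequences.

(** * Factorisation of the cost and comparison of strategies *)

Section leg_filter.
Context {d : measure_display} {Omega : measurableType d} {R : realType}.
Variables (P : probability Omega R) (X eps : nat -> Omega -> R).
Variables (m : nat -> R) (K gamma : nat -> nat -> R) (A Q : nat -> R) (mu : R).
Variable n : nat.
Hypothesis mX : forall t, measurable_fun setT (X t).
Hypothesis meps : forall t, measurable_fun setT (eps t).
Hypothesis hX : gaussian_sequence P X.
Hypothesis hmK : has_mean_cov P X m K.
Hypothesis ric : riccati_solution mu A Q K n gamma.
Local Notation S := (Scoef mu A Q).
Hypothesis gpos : forall l, (1 <= l <= n)%N ->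
  0 <= gamma l l /\ 0 < 1 + S l * gamma l l.
Local Notation Y := (observation A X eps).
Local Notation gam := (@normal_prob R 0 1).

Let v0 l : (1 <= l <= n)%N -> 0 <= gamma l l.
Proof. by move=> /gpos[]. Qed.

Let Sv l : (1 <= l <= n)%N -> 0 < 1 + S l * gamma l l.
Proof. by move=> /gpos[]. Qed.

(** With [Y] and [h] frozen, this is the coefficient of [X t] in [mu / 2 * Q t * (X t - h t) ^+ 2 +
    A t * X t * Y t - (A t * X t) ^+ 2 / 2]; the coefficient of [X t ^+ 2] is [- S t / 2]. *)
Let bcoef (h : nat -> Omega -> R) w t := A t * Y t w - mu * Q t * h t w.

(* The predictor of [X_t] given the first [l] observations, computed under the
   weight accumulated by the estimates [h_1, ..., h_l]. *)
Definition predictor (h : nat -> Omega -> R) (l t : nat) (w : Omega) : R :=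
  kmean m S (bcoef h w) gamma l t.

Definition risk_step (h : nat -> Omega -> R) (t : nat) (w : Omega) : R :=
  leg_step (A t) (mu * Q t) (gamma t t) (predictor h t.-1 t w) (h t w) (Y t w).

Definition risk_step_opt (h : nat -> Omega -> R) (t : nat) (w : Omega) : R :=
  leg_step_opt (A t) (mu * Q t) (gamma t t) (predictor h t.-1 t w) (Y t w).

Definition step_const (t : nat) : R :=
  Num.sqrt (1 + A t ^+ 2 * gamma t t) / Num.sqrt (1 + S t * gamma t t).

Definition loss (h : nat -> Omega -> R) (w : Omega) : R :=
  expR (mu / 2 * \sum_(1 <= t < n.+1) (X t w - h t w) ^+ 2 * Q t).

Let mY := measurable_observation X eps A mX meps.

Section admissible.
Variable h : nat -> Omega -> R.
Hypothesis hadm : admissible n Y h.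

Let measurable_h t k : (1 <= t <= k)%N -> (k <= n)%N ->
  measurable_fun [set: gsig (upto k) Y] (h t : gsig (upto k) Y -> R).
Proof.
move=> /andP[t1 tk] kn; apply: (gsig_sub (upto t) (upto k)).
  by move=> u /= /andP[-> /leq_trans]; exact.
by have := hadm t; rewrite t1 (leq_trans tk kn); exact.
Qed.

Let measurable_Y t k : (1 <= t <= k)%N ->
  measurable_fun [set: gsig (upto k) Y] (Y t : gsig (upto k) Y -> R).
Proof. by move=> tk; exact: measurable_gsig. Qed.

Let measurable_predictor l t k : (l <= k)%N -> (k <= n)%N ->
  measurable_fun [set: gsig (upto k) Y] (predictor h l t : gsig (upto k) Y -> R).
Proof.
move=> + kn; elim: l t => [|l IH] t lk; first exact: measurable_cst.
rewrite /predictor /=; apply: measurable_funD; first exact: IH (ltnW lk).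
apply: measurable_funM => //; apply: measurable_funM => //.
apply: measurable_funB; last by apply: measurable_funM => //; exact: IH (ltnW lk).
by apply: measurable_funB; apply: measurable_funM => //;
  [exact: measurable_Y|exact: measurable_h].
Qed.

Let measurable_risk_step t k : (1 <= t <= k)%N -> (k <= n)%N ->
  measurable_fun [set: gsig (upto k) Y] (risk_step h t : gsig (upto k) Y -> R).
Proof.
move=> tk kn; have tn : (1 <= t <= n)%N.
  by case/andP: tk => -> /leq_trans; exact.
apply: measurable_leg_step.
- exact: v0.
- exact: Sv.
- by apply: measurable_predictor => //; case/andP: tk => _; exact: leq_trans (leq_pred t).
- exact: measurable_h.
- exact: measurable_Y.
Qed.

Lemma risk_step_ge0 t w : (1 <= t <= n)%N -> 0 <= risk_step h t w.
Proof. by move=> tn; apply: leg_step_ge0; [exact: v0|exact: Sv]. Qed.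

Lemma risk_step_prod_ge0 k w : (k <= n)%N -> 0 <= \prod_(1 <= t < k.+1) risk_step h t w.
Proof.
move=> kn; rewrite big_nat; apply: prodr_ge0 => t; rewrite ltnS => /andP[t1 tk].
by apply: risk_step_ge0; rewrite t1 (leq_trans tk kn).
Qed.

Lemma measurable_risk_step_prod k : (k <= n)%N ->
  measurable_fun [set: gsig (upto k) Y]
    (fun w : gsig (upto k) Y => \prod_(1 <= t < k.+1) risk_step h t w).
Proof.
move=> kn; apply: measurable_prod => t; rewrite mem_index_iota ltnS => tk.
exact: measurable_risk_step.
Qed.

Lemma measurable_loss : measurable_fun setT (loss h).
Proof.
rewrite (_ : loss h = fun w => \prod_(1 <= t < n.+1)
    expR (mu / 2 * ((X t w - h t w) ^+ 2 * Q t))); last first.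
  by apply/funext => w; rewrite /loss mulr_sumr expR_sum.
apply: measurable_prod => t; rewrite mem_index_iota ltnS => tn.
have mh := measurableT_comp (measurable_h t n tn (leqnn n))
  (measurable_id_gsig (upto n) Y mY).
apply: measurableT_comp => //; do 2 apply: measurable_funM => //.
by apply: measurable_funX; apply: measurable_funB => //; exact: mh.
Qed.

(** Under [nu] the cost is divided by [likelihood_inv]. Since [h] is a function of the observations,
    independence allows [X] to be integrated under [P] with [Y] and [h] frozen, which is
    [weighted_gaussian_integral]. *)
Lemma risk_steps (nu : probability Omega R) :
  (forall B, measurable B -> nu B = (\int[P]_(w in B) (likelihood_inv X eps A n w)%:E)%E) ->
  (forall E F, <<s sigma_generator times X >> E ->
    <<s sigma_generator (upto n) Y >> F -> nu (E `&` F) = (P E * nu F)%E) ->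
  (\int[P]_w (loss h w)%:E =
   \int[nu]_w (\prod_(1 <= t < n.+1) risk_step h t w)%:E)%E.
Proof.
move=> nuE ind.
pose e (x h y a q : R) := q / 2 * (x - h) ^+ 2 + a * x * y - (a * x) ^+ 2 / 2.
pose g (z : gsig times X * gsig (upto n) Y) : \bar R :=
  (\prod_(1 <= t < n.+1) expR
    (e (X t z.1) (h t z.2) (Y t z.2) (A t) (mu * Q t)))%:E.
have mg : measurable_fun setT g.
  apply/measurable_EFinP; apply: measurable_prod => t.
  rewrite mem_index_iota ltnS => tn; apply: measurableT_comp => //.
  have mx := measurable_fun_fst _ _ _ (gsig times X) (gsig (upto n) Y) R (X t)
    (measurable_gsig times X t (proj1 (andP tn))).
  have mh := measurable_fun_snd _ _ _ (gsig times X) (gsig (upto n) Y) R (h t)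
    (measurable_h t n tn (leqnn n)).
  have my := measurable_fun_snd _ _ _ (gsig times X) (gsig (upto n) Y) R (Y t)
    (measurable_Y t n tn).
  apply: measurable_funB.
    apply: measurable_funD; first apply: measurable_funM => //.
      by apply: measurable_funX; exact: measurable_funB.
    by apply: measurable_funM => //; exact: measurable_funM.
  by apply: measurable_funM => //; apply: measurable_funX; exact: measurable_funM.
have g0 z : (0 <= g z)%E.
  by rewrite lee_fin prodr_ge0// => t _; exact: expR_ge0.
have midX := measurable_id_gsig times X mX.
have midY := measurable_id_gsig (upto n) Y mY.
have [_ H] := @ge0_integral_independent _ _ _ Omega (gsig times X) (gsig (upto n) Y)
  R nu P nu id id midX midY (fun E F mE mF => ind E F mE mF) g mg g0.
transitivity (\int[nu]_w g (w, w))%E.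
  rewrite (ge0_integral_density _ _ _ P nu (likelihood_inv X eps A n)
    (measurable_likelihood_inv X eps A n mX meps)
    (fun w => ltW (likelihood_inv_gt0 X eps A n w)) nuE).
  - apply: eq_integral => w _; rewrite /g/= -EFinM; congr (_%:E).
    rewrite /likelihood_inv -!expR_sum -expRD; congr expR.
    rewrite -big_split/= mulr_sumr; apply: eq_bigr => t _.
    by rewrite /e /observation; field.
  - exact: (measurableT_comp mg (measurable_fun_pair midX midY)).
  - by move=> w; exact: g0.
rewrite H; apply: eq_integral => w' _.
have Ksym t s : (1 <= t <= n)%N -> (1 <= s <= n)%N -> K t s = K s t.
  by move=> /andP[t1 _] /andP[s1 _]; exact: (gaussian_sequence_cov_sym P X m K hmK).
have ric2 t s : (1 <= s <= t)%N -> (t <= n)%N -> gamma t s = K t s -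
    \sum_(1 <= l < s) gamma t l * gamma s l * (S l / (1 + S l * gamma l l)).
  exact: ric.2.
have HW := weighted_gaussian_integral P X n m S (bcoef h w') K gamma mX Ksym
  (gaussian_sequence_mgf P X m K mX hX hmK n) ric2 gpos.
(* The terms in [h ^+ 2] do not involve [X]; they leave the integral and are distributed over the
   factors [risk_step]. *)
pose C := expR (\sum_(1 <= t < n.+1) mu * Q t / 2 * h t w' ^+ 2).
transitivity (\int[P]_w (C%:E * (expR (kexponent X S (bcoef h w') n w))%:E))%E.
  apply: eq_integral => w _; rewrite /g/= -expR_sum -EFinM /C -expRD; congr (expR _)%:E.
  rewrite /kexponent -big_split/=; apply: eq_bigr => t _.
  by rewrite /e /bcoef /Scoef; field.
rewrite ge0_integralZl_EFin ?expR_ge0//; last first.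
  apply/measurable_EFinP; apply: measurableT_comp => //.
  apply: measurable_sum => t; apply: measurable_funB; apply: measurable_funM => //.
  exact: measurable_funX.
rewrite HW -EFinM /C expR_sum /kweight -big_split/=; congr (_%:E).
by apply: eq_bigr => t _; rewrite mulrC.
Qed.

Section comparison.
Variable nu : probability Omega R.
Hypothesis nu_ind : forall k G B, (k < n)%N ->
  <<s sigma_generator (upto k) Y >> G -> measurable B ->
  nu (G `&` Y k.+1 @^-1` B) = (nu G * gam B)%E.
Hypothesis nu_law : forall k B, (k < n)%N -> measurable B ->
  nu (Y k.+1 @^-1` B) = gam B.

Let J k := (\int[nu]_w (\prod_(1 <= t < k.+1) risk_step h t w)%:E)%E.

Let step_const_ge0 t : 0 <= step_const t.
Proof. by rewrite divr_ge0 ?sqrtr_ge0. Qed.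

(** The product and the predictor depend on the first [k] observations only, while [Y k.+1] is
    standard normal and independent of them. Integrating it first gives a constant, by
    [leg_step_opt_integral]. *)
Lemma risk_step_opt_integral k : (k < n)%N ->
  (\int[nu]_w (\prod_(1 <= t < k.+1) risk_step h t w *
    risk_step_opt h k.+1 w)%:E = J k * (step_const k.+1)%:E)%E.
Proof.
move=> kn; have k1 : (1 <= k.+1 <= n)%N by [].
pose opt (z y : R) := leg_step_opt (A k.+1) (mu * Q k.+1) (gamma k.+1 k.+1) z y.
have opt0 z y : 0 <= opt z y by exact: leg_step_opt_ge0.
pose g (z : gsig (upto k) Y * measurableTypeR R) : \bar R :=
  (\prod_(1 <= t < k.+1) risk_step h t z.1 * opt (predictor h k k.+1 z.1) z.2)%:E.
have mprod := measurable_risk_step_prod k (ltnW kn).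
have mg : measurable_fun setT g.
  apply/measurable_EFinP; apply: measurable_funM.
    exact: (measurable_fun_fst _ _ _ (gsig (upto k) Y) (measurableTypeR R) R _ mprod).
  apply: measurable_leg_step_opt.
    apply: (measurable_fun_fst _ _ _ (gsig (upto k) Y) (measurableTypeR R) R
      (predictor h k k.+1)).
    by apply: measurable_predictor => //; exact: ltnW.
  exact: measurable_snd.
have g0 z : (0 <= g z)%E.
  by rewrite lee_fin mulr_ge0// risk_step_prod_ge0// ltnW.
have ind A' B : measurable (A' : set (gsig (upto k) Y)) -> measurable B ->
    nu (id @^-1` A' `&` Y k.+1 @^-1` B) =
    (nu (id @^-1` A') * nu (Y k.+1 @^-1` B))%E.
  by move=> mA mB; rewrite nu_ind// nu_law.
have [H _] := @ge0_integral_independent _ _ _ Omega (gsig (upto k) Y)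
  (measurableTypeR R) R nu nu nu id (Y k.+1)
  (measurable_id_gsig (upto k) Y mY) (mY k.+1) ind g mg g0.
rewrite [LHS]H /g/=.
transitivity (\int[nu]_w ((\prod_(1 <= t < k.+1) risk_step h t w)%:E *
    (step_const k.+1)%:E))%E.
  apply: eq_integral => w _; under eq_integral do rewrite EFinM.
  have mopt : measurable_fun [set: R] (opt (predictor h k k.+1 w)).
    by apply: measurable_leg_step_opt => //; exact: measurable_cst.
  rewrite ge0_integralZl_EFin ?risk_step_prod_ge0 ?(ltnW kn)//; last 2 first.
  - by move=> w' _; rewrite lee_fin.
  - by apply/measurable_EFinP; exact: measurableT_comp.
  congr (_ * _)%E.
  rewrite (@ge0_integral_law _ _ _ nu (Y k.+1) (mY k.+1) gam
    (fun y => (opt (predictor h k k.+1 w) y)%:E)).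
  - by rewrite leg_step_opt_integral ?v0 ?Sv.
  - by move=> B mB; exact: nu_law.
  - exact/measurable_EFinP.
  - by move=> y; rewrite lee_fin.
rewrite ge0_integralZr//.
- apply/measurable_EFinP.
  exact: (measurableT_comp mprod (measurable_id_gsig (upto k) Y mY)).
- by move=> w _; rewrite lee_fin risk_step_prod_ge0// ltnW.
- by rewrite lee_fin step_const_ge0.
Qed.

Let measurable_prod_omega k : (k <= n)%N ->
  measurable_fun setT (fun w => (\prod_(1 <= t < k.+1) risk_step h t w)%:E).
Proof.
move=> kn; apply/measurable_EFinP.
exact: (measurableT_comp (measurable_risk_step_prod k kn)
  (measurable_id_gsig (upto k) Y mY)).
Qed.

Let measurable_prod_opt k : (k < n)%N -> measurable_fun setT
  (fun w => (\prod_(1 <= t < k.+1) risk_step h t w * risk_step_opt h k.+1 w)%:E).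
Proof.
move=> kn; apply/measurable_EFinP; apply: measurable_funM.
  by apply/measurable_EFinP; apply: measurable_prod_omega; exact: ltnW.
apply: measurable_leg_step_opt; last exact: mY.
have mp : measurable_fun [set: gsig (upto k) Y]
    (predictor h k k.+1 : gsig (upto k) Y -> R).
  by apply: measurable_predictor => //; exact: ltnW.
exact: (measurableT_comp mp (measurable_id_gsig (upto k) Y mY)).
Qed.

Let J0 : J 0 = 1%E.
Proof.
rewrite /J; under eq_integral do rewrite big_geq//.
by rewrite integral_cst//= probability_setT mule1.
Qed.

Let prod_opt_ge0 k w : (k < n)%N ->
  (0 <= (\prod_(1 <= t < k.+1) risk_step h t w * risk_step_opt h k.+1 w)%:E)%E.
Proof.
move=> kn; rewrite lee_fin mulr_ge0//.
  by rewrite risk_step_prod_ge0// ltnW.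
exact: leg_step_opt_ge0.
Qed.

Let prod_ge0 k w : (k <= n)%N ->
  (0 <= (\prod_(1 <= t < k.+1) risk_step h t w)%:E)%E.
Proof. by move=> kn; rewrite lee_fin risk_step_prod_ge0. Qed.

(** The last factor is replaced by its minimum over the estimate and then integrated out. No
    finiteness of [J k] is required. *)
Lemma risk_ge k : (forall t, (1 <= t <= n)%N -> 0 <= mu * Q t) -> (k <= n)%N ->
  ((\prod_(1 <= t < k.+1) step_const t)%:E <= J k)%E.
Proof.
move=> q0; elim: k => [|k IH] kn; first by rewrite J0 big_geq.
rewrite big_nat_recr//= EFinM.
apply: (@le_trans _ _ (J k * (step_const k.+1)%:E)%E).
  by apply: lee_wpmul2r; rewrite ?lee_fin// IH// ltnW.
rewrite -risk_step_opt_integral//; apply: ge0_le_integral => //.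
- by move=> w _; exact: prod_opt_ge0.
- exact: measurable_prod_opt.
- exact: measurable_prod_omega.
- move=> w _; rewrite lee_fin [leRHS]big_nat_recr//= ler_wpM2l//.
    by rewrite risk_step_prod_ge0// ltnW.
  by apply: leg_step_opt_le; rewrite ?v0 ?Sv ?q0.
Qed.

(** The same induction with inequalities reversed: when [mu * Q t <= 0], [risk_step_opt] is the
    maximum over the estimate. *)
Lemma risk_le k : (forall t, (1 <= t <= n)%N -> mu * Q t <= 0) -> (k <= n)%N ->
  (J k <= (\prod_(1 <= t < k.+1) step_const t)%:E)%E.
Proof.
move=> q0; elim: k => [|k IH] kn; first by rewrite J0 big_geq.
rewrite big_nat_recr//= EFinM.
apply: (@le_trans _ _ (J k * (step_const k.+1)%:E)%E); last first.
  by apply: lee_wpmul2r; rewrite ?lee_fin// IH// ltnW.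
rewrite -risk_step_opt_integral//; apply: ge0_le_integral => //.
- by move=> w _; exact: prod_ge0.
- exact: measurable_prod_omega.
- exact: measurable_prod_opt.
- move=> w _; rewrite lee_fin [leLHS]big_nat_recr//= ler_wpM2l//.
    by rewrite risk_step_prod_ge0// ltnW.
  by apply: leg_step_opt_ge; rewrite ?v0 ?Sv ?q0.
Qed.

Lemma risk_eq k : (forall t w, (1 <= t <= n)%N ->
    h t w = leg_opt (A t) (gamma t t) (predictor h t.-1 t w) (Y t w)) ->
  (k <= n)%N -> J k = (\prod_(1 <= t < k.+1) step_const t)%:E.
Proof.
move=> hopt; elim: k => [|k IH] kn; first by rewrite J0 big_geq.
rewrite big_nat_recr//= EFinM -IH ?(ltnW kn)// -risk_step_opt_integral//.
apply: eq_integral => w _; rewrite big_nat_recr//=; congr (_ * _)%:E.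
by rewrite /risk_step hopt// leg_step_opt_eq ?v0 ?Sv.
Qed.

End comparison.
End admissible.

(** * The solution of the filter equation *)

Section filter.
Variable h : nat -> Omega -> R.
Hypothesis hfilter : filter_equation A n m gamma Y h.

(** Induction on [l]. If [h l] equals the predictor [z] plus [A l * gamma l l] times the innovation
    [Y l - A l * h l], then the increment [(bcoef - S l * z) / (1 + S l * gamma l l)] in [kmean]
    simplifies to [A l] times that innovation. *)
Lemma filter_predictor l t w : (l <= n)%N -> predictor h l t w =
  m t + \sum_(1 <= j < l.+1) A j * gamma t j * (Y j w - A j * h j w).
Proof.
elim: l t => [|l IH] t ln; first by rewrite big_geq// addr0.
have l1 : (1 <= l.+1 <= n)%N by [].
rewrite /predictor /= -/(predictor h l t w) -/(predictor h l l.+1 w).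
rewrite !IH ?(ltnW ln)// [in RHS]big_nat_recr//= [RHS]addrA; congr (_ + _).
have := hfilter l.+1 l1 w; rewrite big_nat_recr//= addrA.
set z := m _ + _ => hz.
have -> : z = h l.+1 w - A l.+1 * gamma l.+1 l.+1 *
    (Y l.+1 w - A l.+1 * h l.+1 w) by rewrite [in X in X - _]hz addrK.
rewrite /bcoef /Scoef; field.
by rewrite gt_eqF// Sv.
Qed.

(** The filter equation contains [h t] on both sides; solving it for [h t] gives [leg_opt]. *)
Lemma filter_leg_opt t w : (1 <= t <= n)%N ->
  h t w = leg_opt (A t) (gamma t t) (predictor h t.-1 t w) (Y t w).
Proof.
move=> tn; have [t1 tn'] := andP tn.
rewrite filter_predictor ?(leq_trans (leq_pred t))// prednK//.
have := hfilter t tn w; rewrite big_nat_recr//= addrA /leg_opt.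
set z := m t + _ => hz.
have g1 : 1 + A t ^+ 2 * gamma t t != 0.
  by rewrite gt_eqF// ltr_wpDr// mulr_ge0 ?sqr_ge0 ?v0.
apply/(mulIf g1); rewrite divfK// mulrDr mulr1 {1}hz; ring.
Qed.

(** Strong induction on [t], from the explicit form of [h t], which involves only earlier estimates
    and the observations up to [t]. *)
Lemma filter_admissible : admissible n Y h.
Proof.
move=> t; elim/ltn_ind: t => t IH tn; have [t1 tn'] := andP tn.
pose z w := m t + \sum_(1 <= j < t) A j * gamma t j * (Y j w - A j * h j w).
have hE : h t = (fun w => leg_opt (A t) (gamma t t) (z w) (Y t w)).
  apply/funext => w; rewrite filter_leg_opt// filter_predictor ?prednK//.
  exact: leq_trans (leq_pred t) _.
have mYt s : (1 <= s <= t)%N ->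
    measurable_fun [set: gsig (upto t) Y] (Y s : gsig (upto t) Y -> R).
  by move=> st; exact: measurable_gsig.
rewrite /= hE; apply: measurable_leg_opt; last by apply: mYt; rewrite t1 leqnn.
(* Terms outside the range are set to 0 because [measurable_sum] asks for measurability at every
   index. *)
rewrite (_ : z = fun w => m t + \sum_(1 <= j < t) (if (1 <= j < t)%N then
    A j * gamma t j * (Y j w - A j * h j w) else 0)); last first.
  by apply/funext => w; congr (_ + _); apply: eq_big_nat => j ->.
apply: measurable_funD => //; apply: measurable_sum => j.
case jt' : (1 <= j < t)%N; last exact: measurable_cst.
have /andP[j1 jt] := jt'.
apply: measurable_funM => //; apply: measurable_funB.
  by apply: mYt; rewrite j1 ltnW.
apply: measurable_funM => //; apply: (gsig_sub (upto j) (upto t)).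
  by move=> u /= /andP[-> /leq_trans]; apply; exact: ltnW.
by apply: IH => //; rewrite j1 (leq_trans (ltnW jt)).
Qed.

End filter.
End leg_filter.

Section signed_scaling.
Context {d : measure_display} {T : measurableType d} {R : realType}.
Variable P : probability T R.
Local Open Scope ereal_scope.

(** The integral of [f] may be infinite and [c] negative; that case is reduced to [- c] through the
    negation of a nonnegative integrand. *)
Lemma expectation_scale (c : R) (f : T -> R) : measurable_fun setT f ->
  (forall w, 0 <= f w)%R ->
  'E_P[(fun w => c * f w)%R] = c%:E * \int[P]_w (f w)%:E.
Proof.
move=> mf f0; rewrite unlock.
have mfE : measurable_fun setT (EFin \o f) by exact/measurable_EFinP.
have f0E w : setT w -> 0 <= (EFin \o f) w by move=> _; rewrite lee_fin.
have pos (b : R) : (0 <= b)%R ->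
    \int[P]_w (b * f w)%:E = b%:E * \int[P]_w (f w)%:E.
  by move=> b0; under eq_integral do rewrite EFinM; rewrite ge0_integralZl_EFin.
have [c0|c0] := leP 0%R c; first exact: pos.
transitivity (\int[P]_w (- ((- c) * f w)%:E)).
  by apply: eq_integral => w _; rewrite -EFinN mulNr opprK.
rewrite integral_ge0N; last first.
  by move=> w _; rewrite lee_fin mulr_ge0// oppr_ge0 ltW.
by rewrite pos ?oppr_ge0 ?ltW// EFinN mulNe oppeK.
Qed.

End signed_scaling.

(** * Optimality of the filter and value of the risk *)

Theorem theorem1 (d : measure_display) (Omega : measurableType d)
  (R : realType) (P : probability Omega R)
  (X eps : nat -> {RV P >-> R})
  (m : nat -> R) (K : nat -> nat -> R)
  (A Q : nat -> R) (mu : R) (T : nat)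
  (hX : gaussian_sequence P (fun t => X t : Omega -> R))
  (hmK : has_mean_cov P (fun t => X t : Omega -> R) m K)
  (heps : iid_standard_normal P (fun t => eps t : Omega -> R))
  (hXeps : independent_sequences P [set t | (1 <= t)%N]
             (fun t => X t : Omega -> R) (fun t => eps t : Omega -> R))
  (hQ : forall t, (1 <= t)%N -> 0 <= Q t)
  (hT : (1 <= T)%N)
  (hC : condition_C mu A Q K T)
  (gamma : nat -> nat -> R) (hgamma : riccati_solution mu A Q K T gamma)
  (hbar : nat -> Omega -> R)
  (hhbar : filter_equation A T m gamma (observation A X eps) hbar) :
  leg_optimal P mu Q T X (observation A X eps) hbar /\
  leg_risk P mu Q T X hbar =
    (mu * \prod_(1 <= t < T.+1)
            ((1 + Scoef mu A Q t * gamma t t) / (1 + A t ^+ 2 * gamma t t))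
              `^ (- 2^-1))%:E.
Proof.
(* By uniqueness [gamma] coincides with the solution [g] of the condition, hence inherits its
   positivity properties. *)
have [g [_ guniq _ gpos0]] := hC.
have gpos l : (1 <= l <= T)%N ->
    0 <= gamma l l /\ 0 < 1 + Scoef mu A Q l * gamma l l.
  move=> lT; have [l1 lT'] := andP lT.
  by rewrite (guniq gamma hgamma l l) ?l1 ?leqnn//; exact: gpos0.
pose X' t : Omega -> R := X t; pose eps' t : Omega -> R := eps t.
have mX t : measurable_fun setT (X' t) by exact: measurable_funPT.
have meps t : measurable_fun setT (eps' t) by exact: measurable_funPT.
have [nu [nuE ind nu_ind nu_law]] :=
  reference_measure P X' eps' A T mX meps heps hXeps.
have adm : admissible T (observation A X' eps') hbar.
  exact: (filter_admissible X' eps' m gamma A Q mu T gpos hbar hhbar).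
have opt := filter_leg_opt X' eps' m gamma A Q mu T gpos hbar hhbar.
pose J h := (\int[P]_w (loss X' Q mu T h w)%:E)%E.
pose C := \prod_(1 <= t < T.+1) step_const gamma A Q mu t.
have Jbar : J hbar = C%:E.
  rewrite /J (risk_steps P X' eps' m K gamma A Q mu T mX meps hX hmK hgamma gpos
    hbar adm nu nuE ind).
  exact: (risk_eq X' eps' m gamma A Q mu T mX meps gpos hbar adm nu nu_ind
    nu_law T opt).
have riskE h : admissible T (observation A X' eps') h ->
    leg_risk P mu Q T X h = (mu%:E * J h)%E.
  move=> hadm; apply: expectation_scale.
    exact: (measurable_loss X' eps' A Q mu T mX meps h hadm).
  by move=> w; exact: expR_ge0.
split; last first.
  rewrite riskE// Jbar -EFinM /C; congr (mu * _)%:E.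
  apply: eq_big_nat => t tT; rewrite ltnS in tT; have [v0 Sv] := gpos t tT.
  have av : 0 < 1 + A t ^+ 2 * gamma t t.
    by rewrite ltr_wpDr// mulr_ge0// sqr_ge0.
  rewrite powRN powR12_sqrt; last by rewrite divr_ge0// ltW.
  by rewrite sqrtrM ?(ltW Sv)// sqrtrV ?(ltW av)// invf_div.
split => // h hadm; rewrite !riskE// Jbar.
have RS := risk_steps P X' eps' m K gamma A Q mu T mX meps hX hmK hgamma gpos
  h hadm nu nuE ind.
(* For [0 <= mu] the exponential integral must be minimal at [hbar]. For [mu < 0] multiplication by
   [mu] reverses the order, so it must be maximal there, and [risk_le] replaces [risk_ge]. *)
have [mu0|mu0] := leP 0 mu.
  apply: lee_wpmul2l; first by rewrite lee_fin.
  rewrite /J RS; apply: (risk_ge X' eps' m gamma A Q mu T mX meps gpos h hadm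
    nu nu_ind nu_law T) => // t /andP[t1 _].
  by rewrite mulr_ge0// hQ.
rewrite -(opprK mu) EFinN !mulNe leeN2; apply: lee_wpmul2l.
  by rewrite lee_fin oppr_ge0 ltW.
rewrite /J RS; apply: (risk_le X' eps' m gamma A Q mu T mX meps gpos h hadm
  nu nu_ind nu_law T) => // t /andP[t1 _].
by rewrite mulr_le0_ge0 ?hQ// ltW.
Qed.
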